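(* Let $A$ and $A'$ be finite PTSs (with $A'$ over actions $\Sigma_{\mathcal F}$). Whether $A\preceq_m A'$ holds can be decided in time $O(\mathrm{Poly}(m\cdot m'))$, where $m$ and $m'$ are the sizes of the transition relations of $A$ and $A'$, respectively.
   Context: For a set $S$, $\mathcal D(S)$ is the set of probability distributions on $S$ and $\Delta_s$ the Dirac distribution at $s$. A coupling of $\mu\in\mathcal D(S)$ and $\mu'\in\mathcal D(S')$ is $w\in\mathcal D(S\times S')$ with $\sum_{t'}w(t,t')=\mu(t)$ and $\sum_t w(t,t')=\mu'(t')$. For $R\subseteq S\times S'$, $\mu\,R^{\#}\,\mu'$ iff some coupling $w$ of $(\mu,\mu')$ satisfies $w(t,t')>0\Rightarrow t\,R\,t'$. A PTS is $(S,\Sigma,\rightarrow,s_0)$ with state set $S$, initial state $s_0$, actions $\Sigma$, ${\rightarrow}\subseteq S\times\Sigma\times\mathcal D(S)$, every state having an outgoing transition. $\mathcal F$ is a finite set of fault labels disjoint from $\Sigma$ and $\Sigma_{\mathcal F}=\Sigma\cup\mathcal F$. For $A=(S,\Sigma,\rightarrow,s_0)$ and $A'=(S',\Sigma_{\mathcal F},\rightarrow',s_0')$, $A\preceq_m A'$ (strong probabilistic masking fault-tolerance) iff there is $\mathbf M\subseteq S\times S'$ with $s_0\,\mathbf M\,s_0'$ such that whenever $s\,\mathbf M\,s'$, for all $e\in\Sigma$ and $F\in\mathcal F$: (1) if $s\xrightarrow{e}\mu$ then $s'\xrightarrow{e}{}'\mu'$ and $\mu\,\mathbf M^{\#}\mu'$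 for some $\mu'$; (2) if $s'\xrightarrow{e}{}'\mu'$ then $s\xrightarrow{e}\mu$ and $\mu\,\mathbf M^{\#}\mu'$ for some $\mu$; (3) if $s'\xrightarrow{F}{}'\mu'$ then $\Delta_s\,\mathbf M^{\#}\mu'$. *)

(* Defs.v *)
From HB Require Import structures.
From mathcomp Require Import all_boot all_order all_algebra finmap.

Set Implicit Arguments.
Unset Strict Implicit.
Unset Printing Implicit Defensive.

Import Order.TTheory GRing.Theory Num.Theory.
Local Open Scope ring_scope.
Local Open Scope fset_scope.

Section Distributions.

Variable R : realFieldType.

Definition is_dist (S : finType) (f : {ffun S -> R}) : bool :=
  [forall t, 0 <= f t] && (\sum_t f t == 1).

Record dist (S : finType) := Dist {
  dist_fun :> {ffun S -> R};
  dist_funP : is_dist dist_fun }.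

HB.instance Definition _ (S : finType) := [isSub for @dist_fun S].
HB.instance Definition _ (S : finType) := [Choice of dist S by <:].

Lemma dirac_subproof (S : finType) (s : S) :
  is_dist [ffun t => if t == s then 1 else 0 : R].
Proof.
apply/andP; split; first by apply/forallP => t; rewrite ffunE; case: ifP.
by under eq_bigr do rewrite ffunE; rewrite -big_mkcond /= big_pred1_eq.
Qed.

Definition dirac (S : finType) (s : S) : dist S := Dist (dirac_subproof s).

Definition coupling (S S' : finType) (w : dist (S * S')%type)
    (mu : dist S) (mu' : dist S') : Prop :=
  (forall t, \sum_t' w (t, t') = mu t) /\ (forall t', \sum_t w (t, t') = mu' t').

Definition lift_rel (S S' : finType) (M : S -> S' -> Prop)
    (mu : dist S) (mu' : dist S') : Prop :=
  exists2 w : dist (S * S')%type, coupling w mu mu' &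
    forall t t', 0 < w (t, t') -> M t t'.

Record pts (S Act : finType) := PTS {
  trans : {fset S * Act * dist S};
  init : S;
  trans_total : forall s, exists a mu, (s, a, mu) \in trans }.

Definition trans_size (S Act : finType) (A : pts S Act) : nat := #|` trans A|.

(* Sigma and F are made disjoint by taking the sum type Sigma + F as the set
   of actions of the faulty system.  The quantifiers over Sigma and over F are
   attached to the clauses that use them, so that an empty F makes only the
   last clause vacuous. *)
Definition is_masking (Sigma F S S' : finType)
    (A : pts S Sigma) (A' : pts S' (Sigma + F)%type)
    (M : S -> S' -> Prop) : Prop :=
  M (init A) (init A') /\
  forall s s', M s s' ->
  [/\ forall (e : Sigma) mu, (s, e, mu) \in trans A ->
        exists2 mu', (s', inl e, mu') \in trans A' & lift_rel M mu mu',
      forall (e : Sigma) mu', (s', inl e, mu') \in trans A' ->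
        exists2 mu, (s, e, mu) \in trans A & lift_rel M mu mu' &
      forall (f : F) mu', (s', inr f, mu') \in trans A' ->
        lift_rel M (dirac s) mu'].

Definition masking (Sigma F S S' : finType)
    (A : pts S Sigma) (A' : pts S' (Sigma + F)%type) : Prop :=
  exists M : S -> S' -> Prop, is_masking A A' M.

End Distributions.

(* Model of computation: a random-access machine with structured programs.
   Its memory consists of named unbounded arrays of two sorts, indices (in nat)
   and numbers (in an ordered field R); a scalar variable is a cell 0.  Programs
   are syntax: they do not depend on R and contain only natural constants.
   Evaluating one node of an expression or of a test, and one command, takes
   one unit of time.

   Both sorts are restricted to addition, subtraction and comparison, with
   multiplication and division deliberately absent.  Over rational inputs, t
   units of time therefore produce only numbers that are integer combinations
   of the inputs and of constants, with coefficients in O(2^t), hence of bit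
   length O(t) plus that of a common denominator and of the data.  This makes
   unit cost an honest measure: up to a polynomial it agrees with Turing machine
   time on the bit representation. *)
Inductive iexp : Type :=
| IConst of nat
| IRead of nat & iexp           (* array name, address *)
| IAdd of iexp & iexp
| ISub of iexp & iexp.          (* truncated *)

Inductive nexp : Type :=
| NConst of nat
| NRead of nat & iexp           (* array name, address *)
| NAdd of nexp & nexp
| NSub of nexp & nexp.

Inductive test : Type :=
| ILe of iexp & iexp
| NLe of nexp & nexp.

Inductive com : Type :=
| Skip
| IWrite of nat & iexp & iexp   (* array name, address, value *)
| NWrite of nat & iexp & nexp   (* array name, address, value *)
| Seq of com & com
| If of test & com & com
| While of test & com.

Fixpoint itime (e : iexp) : nat :=
  match e with
  | IConst _ => 1
  | IRead _ e1 => (itime e1).+1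
  | IAdd e1 e2 | ISub e1 e2 => (itime e1 + itime e2).+1
  end%N.

Fixpoint ntime (e : nexp) : nat :=
  match e with
  | NConst _ => 1
  | NRead _ e1 => (itime e1).+1
  | NAdd e1 e2 | NSub e1 e2 => (ntime e1 + ntime e2).+1
  end%N.

Definition ttime (b : test) : nat :=
  match b with
  | ILe e1 e2 => (itime e1 + itime e2).+1
  | NLe e1 e2 => (ntime e1 + ntime e2).+1
  end%N.

Section Semantics.

Variable R : realFieldType.

Record store := Store {
  iarr : nat -> nat -> nat;
  narr : nat -> nat -> R }.

Definition upd (T : Type) (f : nat -> nat -> T) (a i : nat) (v : T) :
    nat -> nat -> T :=
  fun b j => if (b == a) && (j == i) then v else f b j.

Fixpoint ieval (st : store) (e : iexp) : nat :=
  match e with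
  | IConst n => n
  | IRead a e1 => iarr st a (ieval st e1)
  | IAdd e1 e2 => ieval st e1 + ieval st e2
  | ISub e1 e2 => ieval st e1 - ieval st e2
  end%N.

Fixpoint neval (st : store) (e : nexp) : R :=
  match e with
  | NConst n => n%:R
  | NRead a e1 => narr st a (ieval st e1)
  | NAdd e1 e2 => neval st e1 + neval st e2
  | NSub e1 e2 => neval st e1 - neval st e2
  end.

Definition teval (st : store) (b : test) : bool :=
  match b with
  | ILe e1 e2 => (ieval st e1 <= ieval st e2)%N
  | NLe e1 e2 => neval st e1 <= neval st e2
  end.

(* exec c st t st' : started in st, the program c halts in st' after t units
   of time. *)
Inductive exec : com -> store -> nat -> store -> Prop :=
| ExecSkip st : exec Skip st 1%N st
| ExecIWrite a i e st :
    exec (IWrite a i e) st (itime i + itime e).+1%N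
      (Store (upd (iarr st) a (ieval st i) (ieval st e)) (narr st))
| ExecNWrite a i e st :
    exec (NWrite a i e) st (itime i + ntime e).+1%N
      (Store (iarr st) (upd (narr st) a (ieval st i) (neval st e)))
| ExecSeq c1 c2 st st1 st2 t1 t2 :
    exec c1 st t1 st1 -> exec c2 st1 t2 st2 ->
    exec (Seq c1 c2) st (t1 + t2).+1%N st2
| ExecIf b c1 c2 st st1 t :
    exec (if teval st b then c1 else c2) st t st1 ->
    exec (If b c1 c2) st (ttime b + t).+1%N st1
| ExecWhileF b c st :
    teval st b = false ->
    exec (While b c) st (ttime b).+1 st
| ExecWhileT b c st st1 st2 t1 t2 :
    teval st b = true ->
    exec c st t1 st1 -> exec (While b c) st1 t2 st2 ->
    exec (While b c) st (ttime b + t1 + t2).+1%N st2.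

(* The answer is left in cell 0 of index array 0. *)
Definition accepting (st : store) : bool := iarr st 0%N 0%N != 0%N.

Definition label_code (Sigma F : finType) (l : Sigma + F) : nat :=
  match l with
  | inl e => enum_rank e
  | inr f => (#|Sigma| + enum_rank f)%N
  end.

(* Initial memory.  States and labels are given by their ranks, the transitions
   in the order of the enumeration of the finite set, and all cells not listed
   below hold 0.
     index array 0     |S|, number of transitions and initial state of A,
                       the same data for A', then |Sigma|
     index arrays 1, 2 sources and labels of the transitions of A
     index arrays 3, 4 sources and labels of the transitions of A';
                       a label is a fault iff its code is at least |Sigma|
     number arrays 0, 1 the distributions of the transitions of A and of A',
                       in row-major order (one row per transition) *)
Definition input (Sigma F S S' : finType)
    (A : pts R S Sigma) (A' : pts R S' (Sigma + F)%type) : store :=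
  Store
    (fun a i =>
       match a with
       | 0 => nth 0 [:: #|S|; trans_size A; nat_of_ord (enum_rank (init A));
                        #|S'|; trans_size A'; nat_of_ord (enum_rank (init A'));
                        #|Sigma|] i
       | 1 => nth 0 [seq nat_of_ord (enum_rank tr.1.1) | tr <- trans A] i
       | 2 => nth 0 [seq label_code (inl tr.1.2 : Sigma + F) | tr <- trans A] i
       | 3 => nth 0 [seq nat_of_ord (enum_rank tr.1.1) | tr <- trans A'] i
       | 4 => nth 0 [seq label_code tr.1.2 | tr <- trans A'] i
       | _ => 0
       end%N)
    (fun a i =>
       match a with
       | 0%N => nth 0 [seq tr.2 s | tr : S * Sigma * dist R S <- trans A,
                                  s : S <- enum S] i
       | 1%N => nth 0 [seq tr.2 s | tr : S' * (Sigma + F) * dist R S' <- trans A',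
                                  s : S' <- enum S'] i
       | _ => 0
       end).

End Semantics.

(* Main.v *)
Require Import Defs.
From mathcomp Require Import all_boot all_order all_algebra finmap zify ring lra.

(* The largest masking relation is reached from S x S' by repeatedly deleting the
   pairs that violate one of the three clauses; a round that deletes nothing
   means that the rest is a masking relation, so |S| |S'| rounds suffice, and
   |S| <= m, |S'| <= m' because every state has a transition.

   Each round needs to know whether two distributions are related by the lifting
   of the current relation, which is a transportation problem.  It is solved by
   push-relabel, which only adds, subtracts and compares, and whose number of
   steps is bounded in the number of nodes alone.  If all excess is gone, the
   flow is a coupling.  If a node with excess is higher than the number of
   nodes, some height below it is not taken, and the nodes above that gap form a
   cut which no coupling can cross.

   The programs used here have only loops with a bound fixed in advance, so
   their running time is read off the syntax. *)

Set Implicit Arguments.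
Unset Strict Implicit.
Unset Printing Implicit Defensive.

Import Order.TTheory GRing.Theory Num.Theory.

(** * Bounded loop programs *)

(** Loops with fixed bounds cannot stop early, so surplus iterations must be harmless: a sweep over
    a network without active nodes changes nothing, and a round at a fixed point deletes nothing.
    The correctness statements thus take the form that either a natural-number measure has dropped
    or nothing changes any more; after enough iterations only the second case is left.

    Masking quantifies over arbitrary propositional relations, while the program keeps a table of
    bits. Only inclusions connect the two: every masking relation stays inside the current table,
    because the clauses are monotone in the relation, and the final table is itself a masking
    relation. No given relation ever has to be decided.

    Most facts about memory are persistence facts. Since the arrays written by a program can be read
    off its syntax, these facts reduce to evaluating membership in a list of array names. *)

(* Loop bounds are cells of index array 0, which loop bodies may not write. *)
Inductive lcom : Type :=
| LSkip
| LIWrite of nat & iexp & iexp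
| LNWrite of nat & iexp & nexp
| LSeq of lcom & lcom
| LIf of test & lcom & lcom
| LFor of nat & nat & lcom.       (* counter array, bound cell, body *)

Fixpoint compile (c : lcom) : com :=
  match c with
  | LSkip => Skip
  | LIWrite a i e => IWrite a i e
  | LNWrite a i e => NWrite a i e
  | LSeq c1 c2 => Seq (compile c1) (compile c2)
  | LIf b c1 c2 => If b (compile c1) (compile c2)
  | LFor a b c =>
      Seq (IWrite a (IConst 0) (IConst 0))
        (While (ILe (IAdd (IRead a (IConst 0)) (IConst 1)) (IRead 0 (IConst b)))
           (Seq (compile c)
              (IWrite a (IConst 0) (IAdd (IRead a (IConst 0)) (IConst 1)))))
  end.

Fixpoint iwr (c : lcom) : seq nat :=
  match c with
  | LSkip | LNWrite _ _ _ => [::]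
  | LIWrite a _ _ => [:: a]
  | LSeq c1 c2 | LIf _ c1 c2 => iwr c1 ++ iwr c2
  | LFor a _ c => a :: iwr c
  end.

Fixpoint nwr (c : lcom) : seq nat :=
  match c with
  | LSkip | LIWrite _ _ _ => [::]
  | LNWrite a _ _ => [:: a]
  | LSeq c1 c2 | LIf _ c1 c2 => nwr c1 ++ nwr c2
  | LFor _ _ c => nwr c
  end.

Fixpoint wf (bnds : seq nat) (c : lcom) : bool :=
  match c with
  | LSkip | LNWrite _ _ _ => true
  | LIWrite a _ _ => a != 0
  | LSeq c1 c2 | LIf _ c1 c2 => wf bnds c1 && wf bnds c2
  | LFor a b c => [&& a != 0, a \notin iwr c, b \in bnds & wf bnds c]
  end.

(** [D] stands for a common bound on all loop bounds. Both branches of a conditional are charged,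
    which avoids a maximum. The slack 20 covers the 15 units that an iteration adds to its body, and
    the 12 units for entering and leaving a loop. *)
Fixpoint cost (D : nat) (c : lcom) : nat :=
  match c with
  | LSkip => 1
  | LIWrite _ i e => (itime i + itime e).+1
  | LNWrite _ i e => (itime i + ntime e).+1
  | LSeq c1 c2 => (cost D c1 + cost D c2).+1
  | LIf b c1 c2 => (ttime b + (cost D c1 + cost D c2)).+1
  | LFor _ _ c => D * (cost D c + 20) + 20
  end.

Lemma cost_poly (c : lcom) :
  exists C K, forall D, 0 < D -> cost D c <= C * D ^ K.
Proof.
elim: c => [|a i e|a i e|c1 [C1 [K1 H1]] c2 [C2 [K2 H2]]
  |b c1 [C1 [K1 H1]] c2 [C2 [K2 H2]]|a b c [C [K H]]].
- by exists 1, 0.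
- by exists (itime i + itime e).+1, 0 => D _; rewrite muln1.
- by exists (itime i + ntime e).+1, 0 => D _; rewrite muln1.
(* The sum of the degrees replaces their maximum: both powers of [D] are factors of
   [D ^ (K1 + K2)]. *)
- exists (C1 + C2).+1, (K1 + K2) => D D0 /=.
  have := H1 _ D0; have := H2 _ D0; rewrite expnD.
  have : 0 < D ^ K1 by rewrite expn_gt0 D0.
  have : 0 < D ^ K2 by rewrite expn_gt0 D0.
  by nia.
- exists (C1 + C2 + ttime b).+1, (K1 + K2) => D D0 /=.
  have := H1 _ D0; have := H2 _ D0; rewrite expnD.
  have : 0 < D ^ K1 by rewrite expn_gt0 D0.
  have : 0 < D ^ K2 by rewrite expn_gt0 D0.
  set x := D ^ K1; set y := D ^ K2 => ? ? ? ?.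
  have ? : C1 * x <= C1 * (x * y) by rewrite leq_mul2l; nia.
  have ? : C2 * y <= C2 * (x * y) by rewrite leq_mul2l; nia.
  have ? : (ttime b).+1 <= (ttime b).+1 * (x * y) by rewrite leq_pmulr //; nia.
  by nia.
- exists (C + 40), K.+1 => D D0 /=.
  have := H _ D0; rewrite expnS.
  have : 0 < D ^ K by rewrite expn_gt0 D0.
  set x := D ^ K => ? ?.
  have ? : D * cost D c <= D * (C * x) by rewrite leq_mul2l; lia.
  have ? : D <= D * x by rewrite leq_pmulr.
  by nia.
Qed.

Section Run.

Variable R : realFieldType.
Implicit Types st : store R.

Definition seti st (a i v : nat) : store R := Store (upd (iarr st) a i v) (narr st).

Definition setn st (a i : nat) (v : R) : store R :=
  Store (iarr st) (upd (narr st) a i v).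

(** A loop bound is read once here, whereas the compiled loop rereads it at every test; the two
    agree because a well-formed body leaves index array 0 alone. *)
Fixpoint run (c : lcom) st : store R :=
  match c with
  | LSkip => st
  | LIWrite a i e => seti st a (ieval st i) (ieval st e)
  | LNWrite a i e => setn st a (ieval st i) (neval st e)
  | LSeq c1 c2 => run c2 (run c1 st)
  | LIf b c1 c2 => if teval st b then run c1 st else run c2 st
  | LFor a b c =>
      iteri (iarr st 0 b) (fun i s => seti (run c s) a 0 i.+1) (seti st a 0 0)
  end.

Definition frame (c : lcom) st st' : Prop :=
  (forall a, a \notin iwr c -> iarr st' a =1 iarr st a) /\
  (forall a, a \notin nwr c -> narr st' a =1 narr st a).

Lemma run_frame c st : frame c st (run c st).
Proof.
elim: c st => [|a i e|a i e|c1 IH1 c2 IH2|b c1 IH1 c2 IH2|a b c IH] st //=.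
- split=> // a'; rewrite inE => /negbTE aa' j /=.
  by rewrite /upd aa'.
- split=> // a'; rewrite inE => /negbTE aa' j /=.
  by rewrite /upd aa'.
- have [I1 N1] := IH1 st; have [I2 N2] := IH2 (run c1 st).
  split=> a /=; rewrite mem_cat negb_or => /andP[a1 a2] j.
    by rewrite I2 // I1.
  by rewrite N2 // N1.
- have [I1 N1] := IH1 st; have [I2 N2] := IH2 st.
  split=> a /=; rewrite mem_cat negb_or => /andP[a1 a2] j.
    by case: ifP => _; [rewrite I1 | rewrite I2].
  by case: ifP => _; [rewrite N1 | rewrite N2].
- elim: (iarr st 0 b) => [|k [IHi IHn]] /=.
    split=> // a' /=; rewrite inE negb_or => /andP[/negbTE aa' _] j.
    by rewrite /upd aa'.
  set s := iteri k _ _ in IHi IHn *; have [Ii In] := IH s.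
  split=> a' /=.
    rewrite inE negb_or => /andP[aa' ac] j.
    rewrite /upd (negbTE aa') /= Ii // IHi //= inE negb_or aa' //.
  by move=> ac j; rewrite In // IHn.
Qed.

(** The step premise also receives the frame since loop entry, so facts about arrays that the loop
    does not write need not be part of the invariant [P]. *)
Lemma run_for a b c (P : nat -> store R -> Prop) N st :
  [&& a != 0, a \notin iwr c & 0 \notin iwr c] ->
  iarr st 0 b = N ->
  P 0 (seti st a 0 0) ->
  (forall i st', i < N -> iarr st' a 0 = i -> frame (LFor a b c) st st' ->
     P i st' -> P i.+1 (seti (run c st') a 0 i.+1)) ->
  P N (run (LFor a b c) st).
Proof.
case/and3P=> a0 ac c0 EN P0 PS; rewrite /= EN.
suff: forall k, k <= N ->
    let s := iteri k (fun i s => seti (run c s) a 0 i.+1) (seti st a 0 0) in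
    [/\ P k s, iarr s a 0 = k & frame (LFor a b c) st s].
  by move=> /(_ N (leqnn N))[].
elim=> [_|k IH lkN] /=.
  split=> //; first by rewrite /upd !eqxx.
  split=> // a' /=; rewrite inE negb_or => /andP[/negbTE aa' _] j.
  by rewrite /upd aa'.
have /= [] := IH (ltnW lkN); set s := iteri _ _ _ => Pk sk fk.
split; first exact: PS.
  by rewrite /upd !eqxx.
have [Ii In] := run_frame c s; have [fi fn] := fk.
split=> a' /=.
  rewrite inE negb_or => /andP[aa' a'c] j.
  by rewrite /upd (negbTE aa') /= Ii // fi //= inE negb_or aa'.
by move=> a'c j; rewrite In // fn.
Qed.

Lemma exec_compile bnds D c st :
  wf bnds c -> (forall b, b \in bnds -> iarr st 0 b <= D) ->
  exists t, exec (compile c) st t (run c st) /\ t <= cost D c.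
Proof.
have wf0 c' : wf bnds c' -> 0 \notin iwr c'.
  elim: c' => //= [a i e|c1 IH1 c2 IH2|b c1 IH1 c2 IH2|a b c' IH].
  - by rewrite inE eq_sym.
  - by rewrite mem_cat negb_or => /andP[/IH1-> /IH2->].
  - by rewrite mem_cat negb_or => /andP[/IH1-> /IH2->].
  - by rewrite inE negb_or eq_sym => /and4P[-> _ _ /IH->].
elim: c st => [|a i e|a i e|c1 IH1 c2 IH2|b c1 IH1 c2 IH2|a b c IH] st /= wfc bD.
- by exists 1; split => //; constructor.
- by exists (itime i + itime e).+1; split => //; constructor.
- by exists (itime i + ntime e).+1; split => //; constructor.
- case/andP: wfc => w1 w2.
  have [t1 [e1 l1]] := IH1 st w1 bD.
  have [|t2 [e2 l2]] := IH2 (run c1 st) w2.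
    by move=> b /bD; have [-> //] := run_frame c1 st; apply: wf0.
  exists (t1 + t2).+1; split; last by rewrite ltnS leq_add.
  exact: ExecSeq e1 e2.
- case/andP: wfc => w1 w2.
  have [t1 [e1 l1]] := IH1 st w1 bD; have [t2 [e2 l2]] := IH2 st w2 bD.
  exists (ttime b + if teval st b then t1 else t2).+1; split; last first.
    by case: ifP => _; lia.
  by apply: ExecIf; case: ifP.
- case/and4P: wfc => a0 ac /bD bb wc.
  set f := (fun i s => seti (run c s) a 0 i.+1).
  set N := iarr st 0 b in bb *.
  set W := While _ _.
  have c0 := wf0 _ wc.
  suff [t [et lt]] : exists t, exec W (seti st a 0 0) t (iteri N f (seti st a 0 0))
      /\ t <= N * (cost D c + 20) + 10.
    exists (3 + t).+1; split; last by nia.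
    by apply: ExecSeq et; apply: (ExecIWrite a (IConst 0) (IConst 0) st).
  have inv k : let s := iteri k f (seti st a 0 0) in
      (forall b', iarr s 0 b' = iarr st 0 b') /\ iarr s a 0 = k.
    elim: k => [|k [IHk _]] /=.
      by rewrite /upd !eqxx; split=> // b'; rewrite eq_sym (negbTE a0).
    rewrite /upd !eqxx; split=> // b'; rewrite eq_sym (negbTE a0) /=.
    by have [-> //] := run_frame c (iteri k f (seti st a 0 0)).
  (* Induction on the number [j] of iterations still to come: the while rule peels off the first
     iteration, whereas [iteri] peels off the last, so the store after [k] iterations is named
     explicitly. *)
  suff: forall j k, k + j = N ->
     exists t, exec W (iteri k f (seti st a 0 0)) t (iteri N f (seti st a 0 0))
      /\ t <= j * (cost D c + 20) + 10.
    by move=> /(_ N 0); apply.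
  elim=> [|j IHj] k kj; have [] := inv k; set s := iteri k f _ => s0 sk.
    rewrite addn0 in kj; rewrite -kj -/s.
    exists (ttime (ILe (IAdd (IRead a (IConst 0)) (IConst 1)) (IRead 0 (IConst b)))).+1.
    split => //; apply: ExecWhileF => /=.
    by rewrite s0 sk -/N -kj addn1 ltnn.
  have [|t1 [e1 l1]] := IH s wc.
    by move=> b' b'b; rewrite s0 bD.
  have [|t2 [e2 l2]] := IHj k.+1; first by rewrite -kj addSnnS.
  exists ((ttime (ILe (IAdd (IRead a (IConst 0)) (IConst 1)) (IRead 0 (IConst b))))
     + (t1 + 6).+1 + t2).+1; split; last first.
    by rewrite /=; nia.
  apply: ExecWhileT (e2).
    by rewrite /= s0 sk -/N -kj addn1 -addSnnS leq_addr.
  apply: (ExecSeq e1).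
  have := ExecIWrite a (IConst 0) (IAdd (IRead a (IConst 0)) (IConst 1)) (run c s).
  have [fi _] := run_frame c s.
  by rewrite /= fi // sk (addn1 k).
Qed.

End Run.

(** * Push-relabel *)

Section PushRelabel.

Local Open Scope ring_scope.

Variables (R : realFieldType) (T : finType).
Variables (b : T -> R) (cap : T -> T -> R).

(* [r] is the residual capacity, so that [cap x y - r x y] is the net flow from
   [x] to [y]; a negative excess [e x] is an unmet demand. *)
Record pr_inv (e : T -> R) (h : T -> nat) (r : T -> T -> R) : Prop := PrInv {
  res_ge0 : forall x y, 0 <= r x y;
  res_sym : forall x y, r x y + r y x = cap x y + cap y x;
  exc_def : forall x, e x = b x - \sum_y (cap x y - r x y);
  ht_res : forall x y, 0 < r x y -> (h x <= (h y).+1)%N;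
  ht_neg : forall x, e x < 0 -> h x = 0%N;
  ht_max : forall x, (h x <= #|T|.+1)%N }.

(* Active nodes count with their height.  The bracket of a pair is 1 unless it
   is saturated and its head is not above its tail, so that it drops at a
   saturating push and can only come back when the head is raised. *)
Definition pr_pot (e : T -> R) (h : T -> nat) (r : T -> T -> R) : nat :=
  (\sum_x (0 < e x)%R * h x
   + #|T|.+2 * (\sum_x \sum_y (#|T|.+1 - h y + ((0 < r x y)%R || (h x < h y)%N)))
   + 2 * \sum_x (#|T|.+1 - h x))%N.

(** Networks read from two stores agree only pointwise; this and [pr_inv_eq] transport potential and
    invariant along such agreement. *)
Lemma pr_pot_eq e h r e' h' r' :
  e =1 e' -> h =1 h' -> r =2 r' -> pr_pot e h r = pr_pot e' h' r'.
Proof.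
move=> Ee Eh Er; rewrite /pr_pot; congr (_ + _ * _ + _ * _)%N.
- by apply: eq_bigr => x _; rewrite Ee Eh.
- by apply: eq_bigr => x _; apply: eq_bigr => y _; rewrite Er !Eh.
- by apply: eq_bigr => x _; rewrite Eh.
Qed.

Lemma pr_inv_eq e h r e' h' r' :
  e =1 e' -> h =1 h' -> r =2 r' -> pr_inv e h r -> pr_inv e' h' r'.
Proof.
move=> Ee Eh Er [i1 i2 i3 i4 i5 i6]; split.
- by move=> x y; rewrite -Er.
- by move=> x y; rewrite -!Er.
- by move=> x; rewrite -Ee i3; congr (_ - _); apply: eq_bigr => y _; rewrite Er.
- by move=> x y; rewrite -Er -!Eh; apply: i4.
- by move=> x; rewrite -Ee -Eh; apply: i5.
- by move=> x; rewrite -Eh.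
Qed.

(** Heights and brackets with their offsets are at most [U], so the middle sum contributes at most
    [U ^ 4] and the outer two at most [3 * U ^ 2]. The 3 in [U] makes [3 <= U], which lets one more
    factor absorb the remainder. *)
Lemma pr_pot_bound e h r (U := (#|T| + 3)%N) :
  pr_inv e h r -> (pr_pot e h r <= U ^ 5)%N.
Proof.
move=> I; have hm := ht_max I; rewrite /pr_pot.
set s1 := (\sum_x _)%N; set s2 := (\sum_x (\sum_y _))%N; set s3 := (\sum_x _)%N.
have l1 : (s1 <= #|T| * U)%N.
  rewrite -sum_nat_const; apply: leq_sum => x _.
  by have := hm x; rewrite /U; case: (0 < e x) => /=; lia.
have l3 : (s3 <= #|T| * U)%N.
  by rewrite -sum_nat_const; apply: leq_sum => x _; rewrite /U; lia.
have l2 : (s2 <= #|T| * (#|T| * U))%N.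
  rewrite -sum_nat_const; apply: leq_sum => x _.
  rewrite -sum_nat_const; apply: leq_sum => y _.
  by rewrite /U; case: (_ || _) => /=; lia.
rewrite /U in l1 l2 l3 *; move: #|T| l1 l2 l3 => n l1 l2 l3.
apply: (@leq_trans (n * (n + 3) + n.+2 * (n * (n * (n + 3))) + 2 * (n * (n + 3)))).
  by rewrite !leq_add // leq_mul.
rewrite !expnS expn0; set p := (n + 3)%N.
have : (n <= p)%N by lia.
have : (n.+2 <= p)%N by lia.
have : (3 <= p)%N by lia.
move: p => p p3 np1 np.
have q1 : (n.+2 * (n * (n * p)) <= p * (p * (p * p)))%N by rewrite !leq_mul.
have q2 : (n * p <= p * p)%N by rewrite leq_mul.
have q3 : (3 * (p * p) <= p * (p * (p * p)))%N by rewrite leq_mul // leq_pmull; lia.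
have q4 : (3 * (p * (p * (p * p))) <= p * (p * (p * (p * p))))%N by rewrite leq_mul.
by nia.
Qed.

Lemma pr_inv_init : (forall x y, 0 <= cap x y) -> pr_inv b (fun=> 0%N) cap.
Proof.
move=> c0; split=> // x.
by rewrite big1 ?subr0 // => y _; rewrite subrr.
Qed.

Section Step.

Variables (e : T -> R) (h : T -> nat) (r : T -> T -> R) (x y : T).
Hypothesis inv : pr_inv e h r.
Hypotheses (ex : 0 < e x) (rxy : 0 < r x y) (hxy : h x = (h y).+1).

Lemma push_neq : (x == y) = false.
Proof. by apply/eqP => xy; move/eqP: hxy; rewrite xy ltn_eqF. Qed.

Lemma push_inv (d : R) (e' : T -> R) (r' : T -> T -> R) :
  0 <= d -> d <= e x -> d <= r x y ->
  (forall z, e' z = if z == x then e z - d else if z == y then e z + d else e z) ->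
  (forall z w, r' z w = if (z == x) && (w == y) then r z w - d
                        else if (z == y) && (w == x) then r z w + d else r z w) ->
  pr_inv e' h r'.
Proof.
case: (inv) => i1 i2 i3 i4 i5 i6 d0 de dr Ee Er.
have xy := push_neq; have yx : (y == x) = false by rewrite eq_sym.
split=> //.
- move=> z w; rewrite Er; case: andP => [[/eqP-> /eqP->]|_]; first by lra.
  by case: ifP => _; have := i1 z w; lra.
- move=> z w; rewrite !Er -(i2 z w).
  have nxy u : ~~ ((u == x) && (u == y)).
    by apply/andP => -[/eqP-> ]; rewrite xy.
  by move: (nxy z) (nxy w); case: (z == x); case: (z == y); case: (w == x);
    case: (w == y) => //= _ _; lra.
- move=> z; rewrite Ee i3.
  have [->|zx] := eqVneq z x.
    rewrite (bigD1 y) //= [in RHS](bigD1 y) //= Er !eqxx /=.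
    under [in RHS]eq_bigr => w /negbTE wy do rewrite Er wy xy andbF /=.
    lra.
  have [->|zy] := eqVneq z y.
    rewrite (bigD1 x) //= [in RHS](bigD1 x) //= Er !eqxx xy yx /=.
    under [in RHS]eq_bigr => w /negbTE wx do rewrite Er wx yx andbF /=.
    lra.
  by congr (_ - _); apply: eq_bigr => w _; rewrite Er (negbTE zx) (negbTE zy).
(* The only arc that may become residual is [(y, x)], and it leads upwards from [h y] to
   [(h y).+1]. *)
- move=> z w; rewrite Er; case: andP => [[/eqP-> /eqP->] _|_]; first by rewrite hxy.
  case: andP => [[/eqP-> /eqP->] _|_]; first by rewrite hxy; lia.
  exact: i4.
- move=> z; rewrite Ee; case: eqP => [->|_]; first by move=> ?; exfalso; lra.
  case: eqP => [->|_]; last exact: i5.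
  by move=> ed; apply: i5; lra.
Qed.

(* A saturating push lowers the bracket of [(x, y)], whose factor outweighs the
   height of a newly active [y]; a non-saturating one trades the height of [x]
   for the smaller height of [y]. *)
Lemma push_pot (d : R) (e' : T -> R) (r' : T -> T -> R) :
  0 < d -> d <= e x -> d <= r x y -> d = e x \/ d = r x y ->
  (forall z, e' z = if z == x then e z - d else if z == y then e z + d else e z) ->
  (forall z w, r' z w = if (z == x) && (w == y) then r z w - d
                        else if (z == y) && (w == x) then r z w + d else r z w) ->
  (pr_pot e' h r' < pr_pot e h r)%N.
Proof.
case: (inv) => i1 i2 i3 i4 i5 i6 d0 de dr dd Ee Er.
have xy := push_neq; have yx : (y == x) = false by rewrite eq_sym.
pose B (r : T -> T -> R) z w :=
  (#|T|.+1 - h w + ((0 < r z w)%R || (h z < h w)%N))%N.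
(* Only the residual of [(y, x)] grows, and its bracket was already 1 because its head [x] is above
   its tail [y]. *)
have leB z w : (B r' z w <= B r z w)%N.
  rewrite /B leq_add2l Er.
  case: andP => [[/eqP-> /eqP->]|_]; first by rewrite rxy /=; case: (_ || _).
  case: andP => [[/eqP-> /eqP->]|_]; last by case: (_ || _).
  by rewrite hxy ltnS leqnn !orbT.
rewrite /pr_pot ltn_add2r -/(B r') -/(B r).
set s1' := (\sum_z _)%N; set s2' := (\sum_z (\sum_w _))%N.
set s1 := (\sum_z _)%N; set s2 := (\sum_z (\sum_w _))%N.
have le2 : (s2' <= s2)%N by apply: leq_sum => z _; apply: leq_sum => w _; apply: leB.
have e1 : (s1' + (0 < e x)%R * h x + (0 < e y)%R * h y
   = s1 + (0 < e' x)%R * h x + (0 < e' y)%R * h y)%N.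
  rewrite /s1 /s1' (bigD1 x) //= [in RHS](bigD1 x) //= (bigD1 y) ?yx //=.
  rewrite [in RHS](bigD1 y) ?yx //=.
  rewrite (_ : (\sum_(i | (i != x) && (i != y)) (0 < e' i)%R * h i
     = \sum_(i | (i != x) && (i != y)) (0 < e i)%R * h i)%N).
    move: (\sum_(i | _) _)%N ((0 < e x)%R * h x)%N ((0 < e y)%R * h y)%N => s0 p q.
    by move: ((0 < e' x)%R * h x)%N ((0 < e' y)%R * h y)%N => p' q'; lia.
  by apply: eq_bigr => z /andP[/negbTE zx /negbTE zy]; rewrite Ee zx zy.
have e'y : (0 < e y) -> (0 < e' y) by rewrite Ee yx eqxx; lra.
have hx := i6 x.
have [dE|dE] := eqVneq d (r x y).
  have lt2 : (s2' < s2)%N.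
    rewrite /s2 /s2' (bigD1 x) //= [ltnRHS](bigD1 x) //= -addSn leq_add //; last first.
      by apply: leq_sum => z _; apply: leq_sum => w _; apply: leB.
    rewrite (bigD1 y) //= [ltnRHS](bigD1 y) //= -addSn leq_add //; last first.
      by apply: leq_sum => w _; apply: leB.
    rewrite Er !eqxx /= dE subrr ltxx rxy /= hxy.
    by rewrite [((h y).+1 < h y)%N]ltnNge leqnSn addn0 addn1.
  have le3 : (#|T|.+2 * s2'.+1 <= #|T|.+2 * s2)%N by rewrite leq_mul2l lt2 orbT.
  have le1 : (s1' + (0 < e y)%R * h y <= s1 + (0 < e' y)%R * h y)%N.
    move: e1; rewrite ex; case: (0 < e' x); rewrite ?mul1n ?mul0n ?addn0;
      clear -s1 s1'; move: s1' s1 (_ * _)%N (_ * _)%N => s1' s1 p q; lia.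
  have := i6 y; move: le3 le1; case: (0 < e' y); rewrite ?mul1n ?mul0n;
    clear; move: s1 s1' s2 s2' ((0 < e y)%R * h y)%N => s1 s1' s2 s2' u; lia.
have {}dE : d = e x by case: dd => // E; rewrite E eqxx in dE.
have e'x : (0 < e' x) = false by rewrite Ee eqxx dE subrr ltxx.
have le3 : (#|T|.+2 * s2' <= #|T|.+2 * s2)%N by rewrite leq_mul2l le2 orbT.
suff lt1 : (s1' < s1)%N by rewrite -addSn leq_add.
move: e1 e'y; rewrite e'x ex hxy mul1n mul0n addn0.
clear; move: s1' s1 => s1' s1.
by case: (0 < e y); [move=> E /(_ isT) ey; rewrite ey in E; move: E| case: (0 < e' y)];
  rewrite ?mul1n ?mul0n ?addn0 //; lia.
Qed.

End Step.

Section Relabel.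

Variables (e : T -> R) (h h' : T -> nat) (r : T -> T -> R) (x : T).
Hypothesis inv : pr_inv e h r.
Hypotheses (ex : 0 < e x) (hx : (h x <= #|T|)%N).
Hypothesis noadm : forall y, 0 < r x y -> h x <> (h y).+1.
Hypothesis h'E : forall z, h' z = if z == x then (h z).+1 else h z.

(** A residual arc from [x] to [y] has [h x] at most [(h y).+1], and equality is excluded by
    [noadm], so there is room for one more. Nodes with a deficit stay at height 0 because [x] has
    positive excess. *)
Lemma relabel_inv : pr_inv e h' r.
Proof.
case: (inv) => i1 i2 i3 i4 i5 i6; split=> //.
- move=> z w rzw; have := i4 _ _ rzw; rewrite !h'E.
  case: eqP => [zx|_]; last by case: ifP; lia.
  by rewrite zx in rzw *; have := noadm rzw; case: ifP; lia.
- move=> z ez; rewrite h'E; case: eqP => [zx|_]; last exact: i5.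
  by exfalso; move: ez ex; rewrite zx; lra.
- by move=> z; rewrite h'E; case: eqP => [->|].
Qed.

(** The first sum rises by 1 and the last one falls by 1, hence the weight 2 of the last. The middle
    sum does not rise: where [x] is the head, the offset falls by 1 while the indicator gains at
    most 1; elsewhere raising a tail can only lower the indicator. *)
Lemma relabel_pot : (pr_pot e h' r < pr_pot e h r)%N.
Proof.
rewrite /pr_pot.
set s1' := (\sum_z _)%N; set s2' := (\sum_z (\sum_w _))%N; set s3' := (\sum_z _)%N.
set s1 := (\sum_z _)%N; set s2 := (\sum_z (\sum_w _))%N; set s3 := (\sum_z _)%N.
have e1 : s1' = s1.+1.
  rewrite /s1 /s1' (bigD1 x) //= [in RHS](bigD1 x) //= h'E eqxx ex !mul1n addSn.
  congr ((_ + _).+1)%N; apply: eq_bigr => z /negbTE zx.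
  by rewrite h'E zx.
have e3 : s3 = s3'.+1.
  rewrite /s3 /s3' (bigD1 x) //= [in RHS](bigD1 x) //= h'E eqxx subSS -addSn subSn //.
  congr ((_ + _).+1)%N; apply: eq_bigr => z /negbTE zx.
  by rewrite h'E zx.
have le2 : (s2' <= s2)%N.
  apply: leq_sum => z _; apply: leq_sum => w _; rewrite !h'E.
  case: (eqVneq w x) => [->|wx]; last first.
    rewrite leq_add2l; case: (0 < r z w) => //=; case: eqP => // _.
    by case: (h z < h w)%N / idP; case: (_ < _)%N / idP => //=; lia.
  rewrite subSS subSn // addSn -addnS leq_add2l.
  by case: (_ || _); case: (_ || _).
have : (#|T|.+2 * s2' <= #|T|.+2 * s2)%N by rewrite leq_mul2l le2 orbT.
lia.
Qed.

End Relabel.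

(** Flow inside a set of nodes cancels. It is applied to all nodes for the global balance and to one
    side of a cut. *)
Lemma sum_antisym (P : pred T) (g : T -> T -> R) :
  (forall x y, g x y = - g y x) -> \sum_(x | P x) \sum_(y | P y) g x y = 0.
Proof.
move=> gN; set s := \sum_(x | _) _.
suff : s = - s by lra.
rewrite {1}/s exchange_big /= -sumrN; apply: eq_bigr => x _.
by rewrite -sumrN; apply: eq_bigr => y _.
Qed.

Section Final.

Variables (e : T -> R) (h : T -> nat) (r : T -> T -> R).
Hypothesis inv : pr_inv e h r.

Lemma net_antisym x y : cap x y - r x y = - (cap y x - r y x).
Proof. by have := res_sym inv x y; lra. Qed.

(** The excesses sum to the total supply, which is 0, so if none is positive then all vanish. *)
Lemma pr_balanced :
  \sum_x b x = 0 -> (forall x, e x <= 0) ->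
  forall x, b x = \sum_y (cap x y - r x y).
Proof.
move=> b0 e0 x.
have : \sum_x - e x = 0.
  rewrite sumrN (eq_bigr _ (fun x _ => exc_def inv x)) big_split /= b0 sumrN.
  by rewrite (sum_antisym xpredT net_antisym) subrr oppr0.
move/eqP; rewrite psumr_eq0 => [/allP /(_ x (mem_index_enum _)) /=|z _]; last first.
  by have := e0 z; lra.
by rewrite (exc_def inv) => /eqP; lra.
Qed.

(* Some value between 1 and [#|T|] is not the height of any node; the nodes
   above it have no residual arc to the nodes below. *)
Lemma pr_cut x :
  0 < e x -> (#|T| < h x)%N ->
  exists X : {set T},
    \sum_(z in X) \sum_(w in ~: X) cap z w < \sum_(z in X) b z.
Proof.
move=> ex hx.
have [g [g0 gT /forallP gh]] :
    exists g, [/\ (0 < g)%N, (g <= #|T|)%N & [forall z, h z != g]].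
  case: (boolP (has (fun g => [forall z, h z != g]) (iota 1 #|T|))).
    by case/hasP => g; rewrite mem_iota => /andP[g0 gT] gh; exists g; split=> //; lia.
  move/hasPn => nh; exfalso.
  (* Pigeonhole: [x] is higher than all [#|T|] values in question, so only the other nodes, one
     fewer than the values, could take them. *)
  have sub : {subset iota 1 #|T| <= [seq h z | z <- enum [set~ x]]}.
    move=> g gi; have /= := nh g gi; rewrite negb_forall => /existsP[z].
    rewrite negbK => /eqP hz; apply/mapP; exists z => //.
    rewrite mem_enum !inE; apply/eqP => zx; move: gi; rewrite mem_iota.
    by rewrite -hz zx; lia.
  have := uniq_leq_size (iota_uniq _ _) sub.
  rewrite size_iota size_map -cardE cardsC1.
  by have : (0 < #|T|)%N by [apply/card_gt0P; exists x]; clear; lia.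
pose X := [set z | (g < h z)%N]; exists X.
(* Leaving [X] means skipping the height [g], a descent by at least 2, which no residual arc
   makes. *)
have res0 z w : z \in X -> w \in ~: X -> r z w = 0.
  rewrite !inE -leqNgt => gz wg; apply: le_anti; rewrite (res_ge0 inv) andbT leNgt.
  by apply/negP => /(ht_res inv); have /eqP := gh w; lia.
have: 0 < \sum_(z in X) e z.
  rewrite (bigD1 x) /= ?inE; last by lia.
  rewrite ltr_pwDl // sumr_ge0 // => z; rewrite inE => /andP[gz _].
  by rewrite leNgt; apply/negP => /(ht_neg inv) hz; rewrite hz in gz.
rewrite (eq_bigr _ (fun z _ => exc_def inv z)) big_split /= sumrN subr_gt0.
congr (_ < _).
(* The net flow out of [X] splits into a part inside [X], which cancels, and a part across the cut,
   where every arc is saturated. *)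
under [LHS]eq_bigr do rewrite (bigID [in X]) /=.
have /= sX0 := sum_antisym [in X] net_antisym.
rewrite big_split /= sX0 add0r.
apply: eq_bigr => z zX; apply: eq_big => w; first by rewrite !inE.
by move=> wX; rewrite (res0 z w) ?subr0 // inE.
Qed.

End Final.

End PushRelabel.

(** * Lifting of a relation as a transportation problem *)

Section Lifting.

Local Open Scope ring_scope.

Variables (R : realFieldType) (S S' : finType) (M : S -> S' -> bool).
Variables (mu : dist R S) (mu' : dist R S').

Definition supply (x : S + S') : R :=
  match x with inl s => mu s | inr s' => - mu' s' end.

(** Capacity 1 serves as infinity, since the total mass to be transported is 1. *)
Definition rcap (x y : S + S') : R :=
  match x, y with inl s, inr s' => (M s s')%:R | _, _ => 0 end.

Lemma dist_ge0 (U : finType) (nu : dist R U) u : 0 <= nu u.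
Proof. by case: nu => f /= /andP[/forallP]. Qed.

Lemma dist_sum (U : finType) (nu : dist R U) : \sum_u nu u = 1.
Proof. by case: nu => f /= /andP[_ /eqP]. Qed.

Lemma supply_sum : \sum_x supply x = 0.
Proof. by rewrite big_sumType /= sumrN !dist_sum subrr. Qed.

Lemma rcap_ge0 x y : 0 <= rcap x y.
Proof. by case: x y => [s|s'] [t|t'] //=; rewrite ler0n. Qed.

Variables (e : S + S' -> R) (h : S + S' -> nat) (r : S + S' -> S + S' -> R).
Hypothesis inv : pr_inv supply rcap e h r.

Lemma pr_feasible : (forall x, e x <= 0) -> lift_rel M mu mu'.
Proof.
move=> e0; have bal := pr_balanced inv supply_sum e0.
have r0 := res_ge0 inv; have rs := res_sym inv.
have rll s t : r (inl s) (inl t) = 0.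
  by have := rs (inl s) (inl t); have := r0 (inl s) (inl t);
     have := r0 (inl t) (inl s); rewrite /=; lra.
have rrr s t : r (inr s) (inr t) = 0.
  by have := rs (inr s) (inr t); have := r0 (inr s) (inr t);
     have := r0 (inr t) (inr s); rewrite /=; lra.
(* A backward arc has capacity 0, so its residual capacity is exactly the flow on the forward arc;
   nonnegativity then comes for free. *)
pose w : {ffun S * S' -> R} := [ffun p => r (inr p.2) (inl p.1)].
have wl s : \sum_s' w (s, s') = mu s.
  have := bal (inl s); rewrite big_sumType /= => ->.
  rewrite [X in X + _]big1 => [|t _]; last by rewrite rll subrr.
  rewrite add0r; apply: eq_bigr => s' _; rewrite ffunE /=.
  by have := rs (inl s) (inr s'); rewrite /=; lra.
have wr s' : \sum_s w (s, s') = mu' s'.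
  have := bal (inr s'); rewrite big_sumType /=.
  rewrite [X in _ + X]big1 => [|t _]; last by rewrite rrr subrr.
  rewrite addr0 => E; rewrite -[RHS]opprK E -sumrN; apply: eq_bigr => s _.
  by rewrite ffunE /=; lra.
have wd : is_dist w.
  apply/andP; split; first by apply/forallP => p; rewrite ffunE r0.
  rewrite (eq_bigr (fun p => w (p.1, p.2))) => [|[]//].
  rewrite -(pair_bigA _ (fun s s' => w (s, s'))) /=.
  by rewrite (eq_bigr _ (fun s _ => wl s)) dist_sum.
exists (Dist wd); first by split.
move=> s s'; rewrite /= ffunE /= => rp.
have := rs (inl s) (inr s'); have := r0 (inl s) (inr s'); rewrite /=.
by case: (M s s') => //=; lra.
Qed.

(** The easy half of max-flow min-cut. Written through the coupling, the supply of [X] is at most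
    the mass sent from [X] to its complement, and each entry of a coupling is at most 1, and 0 at
    unrelated pairs. *)
Lemma lift_cut (X : {set S + S'}) : lift_rel M mu mu' ->
  \sum_(x in X) supply x <= \sum_(x in X) \sum_(y in ~: X) rcap x y.
Proof.
case=> w [wl wr] wM.
have w1 s s' : w (s, s') <= (M s s')%:R.
  case Mss': (M s s') => /=; last first.
    by rewrite leNgt; apply/negP => /wM; rewrite Mss'.
  rewrite -(dist_sum w) (bigD1 (s, s')) //= lerDl sumr_ge0 // => p _.
  exact: dist_ge0.
rewrite !big_mkcond /= !big_sumType /=.
rewrite [X in _ <= _ + X]big1 ?addr0; last first.
  by move=> s' _; rewrite big1.
rewrite [leRHS]big_mkcond /=.
pose P s := inl s \in X; pose P' s' := inr s' \in X.
have -> : \sum_s' (if P' s' then - mu' s' else 0)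
   = - \sum_s \sum_s' (if P' s' then w (s, s') else 0).
  rewrite exchange_big -sumrN; apply: eq_bigr => s' _ /=.
  by case: ifP => _; rewrite ?wr // big1 ?oppr0.
rewrite -sumrB; apply: ler_sum => s _; rewrite -/(P s).
case: ifP => Ps; last first.
  rewrite sub0r oppr_le0 sumr_ge0 // => s' _; case: ifP => // _.
  exact: dist_ge0.
rewrite -wl -sumrB [leRHS]big_mkcond big_sumType /= [X in _ <= X + _]big1 ?add0r.
  apply: ler_sum => s' _; rewrite !inE -/(P' s').
  by case: (P' s') => /=; rewrite ?subrr ?subr0.
by move=> t _; case: ifP.
Qed.

Lemma pr_infeasible x : 0 < e x -> (#|{: S + S'}| < h x)%N -> ~ lift_rel M mu mu'.
Proof.
move=> ex hx /lift_cut cut; have [X] := pr_cut inv ex hx.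
by rewrite ltNge cut.
Qed.

End Lifting.

(** * The decision program *)

(* Memory beyond the input.
     index array 0, cells 7, 8   stride of all square tables, |S| + |S'|
     index arrays 10, 11, 12     multiples of the stride, of |S|, of |S'|
     index array 13              0 at (s, s') iff s and s' are still related
     index array 14              0 at (k, k') iff the distributions of the
                                 transitions k and k' are related by the lifting
     index array 15              0 at (s, k') iff Dirac at s is related by the
                                 lifting to the distribution of transition k'
     index array 16              heights of the nodes of the network
     index arrays 17, 18         failure flags
     number arrays 2, 3, 4       excesses, residual capacities, pushed amount
     index arrays 20 to 33       loop counters *)
Local Notation par i := (IRead 0 (IConst i)).
Local Notation var a := (IRead a (IConst 0)).
Local Notation cell i j := (IAdd (IRead 10 i) j).

Definition if_pos (e : nexp) (c : lcom) : lcom := LIf (NLe e (NConst 0)) LSkip c.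
Definition if_zero (i : iexp) (c : lcom) : lcom := LIf (ILe i (IConst 0)) c LSkip.
Definition if_nzero (i : iexp) (c : lcom) : lcom := LIf (ILe i (IConst 0)) LSkip c.
Definition if_eq (i j : iexp) (c : lcom) : lcom :=
  LIf (ILe i j) (LIf (ILe j i) c LSkip) LSkip.

(** The machine cannot multiply, so row offsets are tabulated once by repeated addition, starting
    from the zeros of fresh memory. *)
Definition tables : lcom :=
  LFor 33 7
    (LSeq (LIWrite 10 (IAdd (var 33) (IConst 1)) (IAdd (IRead 10 (var 33)) (par 7)))
    (LSeq (LIWrite 11 (IAdd (var 33) (IConst 1)) (IAdd (IRead 11 (var 33)) (par 0)))
          (LIWrite 12 (IAdd (var 33) (IConst 1)) (IAdd (IRead 12 (var 33)) (par 3))))).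

Definition heights_init : lcom := LFor 22 8 (LIWrite 16 (var 22) (IConst 0)).

Definition residuals_init : lcom :=
  LFor 22 8 (LFor 23 8 (LNWrite 3 (cell (var 22) (var 23)) (NConst 0))).

Definition supplies_init : lcom :=
  LFor 22 0 (LNWrite 2 (var 22) (NRead 0 (IAdd (IRead 11 (var 20)) (var 22)))).

Definition demands_init : lcom :=
  LFor 23 3
    (LNWrite 2 (IAdd (par 0) (var 23))
       (NSub (NConst 0) (NRead 1 (IAdd (IRead 12 (var 21)) (var 23))))).

Definition capacities_init : lcom :=
  LFor 22 0 (LFor 23 3 (if_zero (IRead 13 (cell (var 22) (var 23)))
    (LNWrite 3 (cell (var 22) (IAdd (par 0) (var 23))) (NConst 1)))).

Definition flow_init : lcom :=
  LSeq heights_init (LSeq residuals_init (LSeq supplies_init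
    (LSeq demands_init capacities_init))).

(** The amount is saved first, since the updates overwrite the residual capacity and the excess from
    which it is computed. *)
Definition push : lcom :=
  LSeq (LIf (NLe (NRead 3 (cell (var 22) (var 23))) (NRead 2 (var 22)))
         (LNWrite 4 (IConst 0) (NRead 3 (cell (var 22) (var 23))))
         (LNWrite 4 (IConst 0) (NRead 2 (var 22))))
  (LSeq (LNWrite 3 (cell (var 22) (var 23))
           (NSub (NRead 3 (cell (var 22) (var 23))) (NRead 4 (IConst 0))))
  (LSeq (LNWrite 3 (cell (var 23) (var 22))
           (NAdd (NRead 3 (cell (var 23) (var 22))) (NRead 4 (IConst 0))))
  (LSeq (LNWrite 2 (var 22) (NSub (NRead 2 (var 22)) (NRead 4 (IConst 0))))
        (LNWrite 2 (var 23) (NAdd (NRead 2 (var 23)) (NRead 4 (IConst 0))))))).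

Definition try_push : lcom :=
  if_pos (NRead 2 (var 22)) (if_pos (NRead 3 (cell (var 22) (var 23)))
    (if_eq (IRead 16 (var 22)) (IAdd (IRead 16 (var 23)) (IConst 1)) push)).

Definition push_all : lcom := LFor 23 8 try_push.

(** Raising by one, rather than to just above the lowest residual neighbour, avoids a search and
    still lowers the potential. *)
Definition relabel : lcom :=
  if_pos (NRead 2 (var 22))
    (LIWrite 16 (var 22) (IAdd (IRead 16 (var 22)) (IConst 1))).

Definition discharge : lcom :=
  LIf (ILe (IRead 16 (var 22)) (par 8))
    (if_pos (NRead 2 (var 22)) (LSeq push_all relabel)) LSkip.

Definition sweep : lcom := LFor 22 8 discharge.

(* The potential of the network is below the fifth power of the stride. *)
Definition flow_loop : lcom :=
  LFor 24 7 (LFor 25 7 (LFor 26 7 (LFor 27 7 (LFor 28 7 sweep)))).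

Definition flow_check : lcom :=
  LSeq (LIWrite 14 (cell (var 20) (var 21)) (IConst 0))
    (LFor 22 8 (if_pos (NRead 2 (var 22))
       (LIWrite 14 (cell (var 20) (var 21)) (IConst 1)))).

Definition flow_body : lcom :=
  LSeq flow_init (LSeq flow_loop flow_check).

Definition lift_phase : lcom := LFor 20 1 (LFor 21 4 flow_body).

Definition dirac_body : lcom :=
  LSeq (LIWrite 15 (cell (var 31) (var 21)) (IConst 0))
    (LFor 23 3 (if_nzero (IRead 13 (cell (var 31) (var 23)))
      (if_pos (NRead 1 (IAdd (IRead 12 (var 21)) (var 23)))
         (LIWrite 15 (cell (var 31) (var 21)) (IConst 1))))).

Definition dirac_phase : lcom := LFor 31 0 (LFor 21 4 dirac_body).

Definition match_pair : lcom :=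
  if_eq (IRead 2 (var 20)) (IRead 4 (var 21))
    (if_zero (IRead 14 (cell (var 20) (var 21))) (LIWrite 18 (IConst 0) (IConst 0))).

Definition fail_if_unmatched : lcom :=
  if_nzero (var 18) (LIWrite 17 (IConst 0) (IConst 1)).

Definition match_left : lcom :=
  LFor 20 1 (if_eq (IRead 1 (var 20)) (var 31)
    (LSeq (LIWrite 18 (IConst 0) (IConst 1))
    (LSeq (LFor 21 4 (if_eq (IRead 3 (var 21)) (var 32) match_pair))
          fail_if_unmatched))).

Definition match_right : lcom :=
  LFor 21 4 (if_eq (IRead 3 (var 21)) (var 32)
    (LIf (ILe (par 6) (IRead 4 (var 21)))
       (if_nzero (IRead 15 (cell (var 31) (var 21))) (LIWrite 17 (IConst 0) (IConst 1)))
       (LSeq (LIWrite 18 (IConst 0) (IConst 1))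
       (LSeq (LFor 20 1 (if_eq (IRead 1 (var 20)) (var 31) match_pair))
             fail_if_unmatched)))).

Definition refine_body : lcom :=
  LSeq (LIWrite 17 (IConst 0) (IConst 0))
  (LSeq match_left (LSeq match_right
     (if_nzero (var 17) (LIWrite 13 (cell (var 31) (var 32)) (IConst 1))))).

(** The tests consult arrays 14 and 15, filled from the relation at the start of the round, so
    deletions within one round do not influence each other. *)
Definition refine_phase : lcom := LFor 31 0 (LFor 32 3 refine_body).

Definition round : lcom := LSeq lift_phase (LSeq dirac_phase refine_phase).

Definition main : lcom := LSeq tables (LFor 29 0 (LFor 30 3 round)).

(** The stride in cell 7 exceeds every column index of the square tables and is large enough for its
    fifth power to bound the potential. These writes stand outside [main] because well-formed loop
    programs may not write index array 0. *)
Definition masking_prog : com :=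
  Seq (IWrite 0 (IConst 7) (IAdd (IAdd (par 0) (par 3))
                             (IAdd (IAdd (par 1) (par 4)) (IConst 3))))
  (Seq (IWrite 0 (IConst 8) (IAdd (par 0) (par 3)))
  (Seq (compile main)
       (IWrite 0 (IConst 0) (ISub (IConst 1) (IRead 13 (cell (par 2) (par 5))))))).

Lemma wf_main : wf [:: 0; 1; 3; 4; 7; 8] main.
Proof. by []. Qed.

Definition safe (c : lcom) : bool :=
  all (fun a => a \notin iwr c) [:: 0; 1; 2; 3; 4; 10; 11; 12] &&
  all (fun a => a \notin nwr c) [:: 0; 1].

Definition loopable (a : nat) (c : lcom) : bool :=
  [&& a != 0, a \notin iwr c & 0 \notin iwr c].

(** * Proof rules for conditionals, flags and loops that fill tables *)

Section Conditionals.

Variable R : realFieldType.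
Implicit Types st : store R.

Lemma run_if_pos e c st :
  run (if_pos e c) st = if (0 < neval st e)%R then run c st else st.
Proof. by rewrite /= ltNge; case: (_ <= _)%R. Qed.

Lemma run_if_zero i c st :
  run (if_zero i c) st = if ieval st i == 0 then run c st else st.
Proof. by rewrite /= leqn0. Qed.

Lemma run_if_nzero i c st :
  run (if_nzero i c) st = if ieval st i == 0 then st else run c st.
Proof. by rewrite /= leqn0. Qed.

Lemma run_if_eq i j c st :
  run (if_eq i j c) st = if ieval st i == ieval st j then run c st else st.
Proof. by rewrite /= eqn_leq; case: (_ <= _); case: (_ <= _). Qed.

(** For sticky flags: an iteration either writes [v] or leaves the cell alone. It serves failures
    with [v] equal to 1 and found matches with [v] equal to 0. *)
Lemma run_for_flag a b c f g v (t : nat -> bool) N st :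
  loopable a c -> a != f -> iarr st 0 b = N ->
  (forall i st', i < N -> iarr st' a 0 = i -> frame (LFor a b c) st st' ->
     iarr (run c st') f g = if t i then v else iarr st' f g) ->
  iarr (run (LFor a b c) st) f g = if has t (iota 0 N) then v else iarr st f g.
Proof.
move=> wl; rewrite eq_sym => /negbTE fa bN H.
apply: (run_for (P := fun k s =>
  iarr s f g = if has t (iota 0 k) then v else iarr st f g) wl bN).
  by rewrite /= /upd fa.
move=> i st' iN ci fr Pi.
rewrite -addn1 iotaD has_cat /= orbF /upd fa /= (H i) // Pi.
by case: (t i); case: (has _ _).
Qed.

(** Counts progress only: a body worth [d] steps gives a loop worth [N * d], so nested loops
    multiply. [E] collects what the whole loop leaves intact. *)
Lemma run_rep (E : store R -> Prop) (Q : nat -> store R -> Prop) a b c d N k st :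
  loopable a c -> iarr st 0 b = N ->
  (forall st', frame (LFor a b c) st st' -> E st') ->
  (forall j st' v, Q j st' -> Q j (seti st' a 0 v)) ->
  (forall j st', E st' -> Q j st' -> Q (j + d) (run c st')) ->
  Q k st -> Q (k + N * d) (run (LFor a b c) st).
Proof.
move=> wl bN HE HQ Hc Qk.
apply: (run_for (P := fun i s => Q (k + i * d) s) wl bN).
  by rewrite mul0n addn0; apply: HQ.
move=> i st' iN ci /HE Est' Qi.
by apply: HQ; rewrite mulSn addnCA addnC; apply: Hc.
Qed.

Lemma addr_inj Z x y x' y' :
  y < Z -> y' < Z -> (x * Z + y == x' * Z + y') = (x == x') && (y == y').
Proof.
move=> yZ y'Z; apply/eqP/andP => [E|[/eqP-> /eqP->] //].
have Z0 : 0 < Z by apply: leq_trans yZ.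
have := congr1 (divn^~ Z) E; have := congr1 (modn^~ Z) E.
rewrite /= !divnMDl // !divn_small // !addn0 !modnMDl !modn_small //.
by move=> -> ->.
Qed.

Section Tables.

Variables (T : Type) (get : store R -> nat -> T).

(** For loops whose iterations touch pairwise distinct cells: each cell is changed at most by its
    own iteration, so [Post] can relate its initial and final contents. [get] abstracts from the
    array and its sort. *)
Lemma run_for1 (Post : nat -> T -> T -> Prop) (ad : nat -> nat) a b c N st :
  loopable a c -> (forall s v, get (seti s a 0 v) =1 get s) ->
  iarr st 0 b = N ->
  (forall i j, i < N -> j < N -> ad i = ad j -> i = j) ->
  (forall i s, i < N -> iarr s a 0 = i -> frame (LFor a b c) st s ->
     (forall p, p <> ad i -> get (run c s) p = get s p) /\
     Post i (get s (ad i)) (get (run c s) (ad i))) ->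
  (forall i, i < N -> Post i (get st (ad i)) (get (run (LFor a b c) st) (ad i))) /\
  (forall p, (forall i, i < N -> p <> ad i) -> get (run (LFor a b c) st) p = get st p).
Proof.
move=> wl ga bN adI H.
pose P (k : nat) (s : store R) :=
  (forall i, i < k -> Post i (get st (ad i)) (get s (ad i))) /\
  (forall p, (forall i, i < k -> p <> ad i) -> get s p = get st p).
apply: (run_for (P := P) wl bN); first by split=> // p _; rewrite ga.
move=> i s iN ci fr [P1 P2]; have [H1 H2] := H i s iN ci fr.
split=> [j|p pi]; rewrite ga.
  rewrite ltnS leq_eqVlt => /orP[/eqP->|ji].
    rewrite P2 // in H2 => j' j'i E.
    by move: (j'i); rewrite -(adI _ _ iN (ltn_trans j'i iN) E) ltnn.
  rewrite H1; first exact: P1.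
  by move=> E; move: (ji); rewrite (adI _ _ (ltn_trans ji iN) iN E) ltnn.
by rewrite H1 ?P2 // => [j ji|]; apply: pi => //; apply: ltnW.
Qed.

Lemma run_for2 (Post : nat -> nat -> T -> T -> Prop) (ad : nat -> nat -> nat)
    a1 b1 a2 b2 c N1 N2 st :
  loopable a2 c -> loopable a1 (LFor a2 b2 c) ->
  (forall s v, get (seti s a1 0 v) =1 get s) ->
  (forall s v, get (seti s a2 0 v) =1 get s) ->
  iarr st 0 b1 = N1 -> iarr st 0 b2 = N2 ->
  (forall i j i' j', i < N1 -> j < N2 -> i' < N1 -> j' < N2 ->
     ad i j = ad i' j' -> i = i' /\ j = j') ->
  (forall i j s, i < N1 -> j < N2 -> iarr s a1 0 = i -> iarr s a2 0 = j ->
     frame (LFor a1 b1 (LFor a2 b2 c)) st s ->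
     (forall p, p <> ad i j -> get (run c s) p = get s p) /\
     Post i j (get s (ad i j)) (get (run c s) (ad i j))) ->
  (forall i j, i < N1 -> j < N2 -> Post i j (get st (ad i j))
      (get (run (LFor a1 b1 (LFor a2 b2 c)) st) (ad i j))) /\
  (forall p, (forall i j, i < N1 -> j < N2 -> p <> ad i j) ->
     get (run (LFor a1 b1 (LFor a2 b2 c)) st) p = get st p).
Proof.
move=> wl2 wl1 g1 g2 bN1 bN2 adI H.
pose P (k : nat) (s : store R) :=
  (forall i j, i < k -> j < N2 -> Post i j (get st (ad i j)) (get s (ad i j))) /\
  (forall p, (forall i j, i < k -> j < N2 -> p <> ad i j) -> get s p = get st p).
apply: (run_for (P := P) wl1 bN1); first by split=> // p _; rewrite g1.
move=> i s iN ci fr [P1 P2].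
have wa1 : a1 \notin iwr (LFor a2 b2 c) by case/and3P: wl1.
have w01 : 0 \notin iwr (LFor a2 b2 c) by case/and3P: wl1.
have bs : iarr s 0 b2 = N2.
  have [f0 _] := fr; rewrite f0 // inE negb_or w01 andbT eq_sym.
  by case/and3P: wl1.
have [| |Q1 Q2] := run_for1 (Post := Post i) (ad := ad i) wl2 g2 bs.
  by move=> j j' jN j'N /adI[].
  move=> j s' jN cj [fr1 fr2]; apply: H => //; first by rewrite fr1.
  case: fr => f1 f2; split=> a aw p; last by rewrite fr2 ?f2.
  by rewrite fr1 ?f1 //; move: aw; rewrite inE negb_or => /andP[].
split=> [i' j i'i jN|p pi]; rewrite g1.
  move: i'i; rewrite ltnS leq_eqVlt => /orP[/eqP->|i'i].
    rewrite -[X in Post _ _ X _]P2; first exact: Q1.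
    by move=> i2 j2 ii jj /adI[] // => [|E]; [apply: ltn_trans iN|rewrite E ltnn in ii].
  have i'N := ltn_trans i'i iN.
  rewrite Q2; first exact: P1.
  by move=> j2 jj /adI[] // E; rewrite E ltnn in i'i.
by rewrite Q2 ?P2 // => [i' j i'i|j] jN; apply: pi => //; apply: ltnW.
Qed.

End Tables.

End Conditionals.

(** * Correctness *)

Lemma rankP (T : finType) i : i < #|T| -> exists x : T, nat_of_ord (enum_rank x) = i.
Proof. by move=> iT; exists (enum_val (Ordinal iT)); rewrite enum_valK. Qed.

Lemma rank_eq (T : finType) (x y : T) :
  (nat_of_ord (enum_rank x) == nat_of_ord (enum_rank y)) = (x == y).
Proof. by rewrite -(inj_eq enum_rank_inj). Qed.

Lemma nth_rank (T : finType) (x0 x : T) : nth x0 (enum T) (enum_rank x) = x.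
Proof. by have := enum_rankK x; rewrite (enum_val_nth x0). Qed.

Lemma nth_allpairs (U V W : Type) (f : U -> V -> W) (w0 : W) (u0 : U) (v0 : V) s t i j :
  i < size s -> j < size t ->
  nth w0 [seq f u v | u <- s, v <- t] (i * size t + j) = f (nth u0 s i) (nth v0 t j).
Proof.
elim: s i => // u s IH [|i] /= si tj; rewrite nth_cat size_map.
  by rewrite mul0n add0n tj (nth_map v0).
by rewrite mulSn -addnA ltnNge leq_addr /= addnC addnK IH.
Qed.

Section Correctness.

Variables (R : realFieldType) (Sigma F S S' : finType).
Variables (A : pts R S Sigma) (A' : pts R S' (Sigma + F)%type).
Implicit Types st : store R.

Local Notation n := #|S|.
Local Notation n' := #|S'|.
Local Notation m := (trans_size A).
Local Notation m' := (trans_size A').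
Local Notation rk x := (nat_of_ord (enum_rank x)).
Let V := n + n'.
Let Z := n + n' + (m + m' + 3).
Let inp := input A A'.

(** Default values for [nth]. *)
Variables (tr0 : S * Sigma * dist R S) (tr0' : S' * (Sigma + F) * dist R S').
Let tr k := nth tr0 (trans A) k.
Let tr' k := nth tr0' (trans A') k.

Definition env0 st : Prop :=
  [/\ forall i, i < 7 -> iarr st 0 i = iarr inp 0 i,
      iarr st 0 7 = Z /\ iarr st 0 8 = V,
      forall a, a \in [:: 1; 2; 3; 4] -> iarr st a =1 iarr inp a &
      forall a, a \in [:: 0; 1] -> narr st a =1 narr inp a].

Definition env st : Prop :=
  env0 st /\ forall k, k <= Z ->
    [/\ iarr st 10 k = k * Z, iarr st 11 k = k * n & iarr st 12 k = k * n'].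

Lemma env_frame c st st' : safe c -> frame c st st' -> env st -> env st'.
Proof.
case/andP=> /allP iw /allP nw [f1 f2] [[e1 e2 e3 e4] e5].
have i0 a : a \in [:: 0; 1; 2; 3; 4; 10; 11; 12] -> iarr st' a =1 iarr st a.
  by move=> /iw; apply: f1.
split; first split.
- by move=> i i7; rewrite i0 // e1.
- by rewrite !i0.
- move=> a aw j; rewrite i0 ?e3 //; move: aw; rewrite !inE.
  by case/or4P=> /eqP->.
- by move=> a aw j; rewrite f2 ?e4 // nw.
- by move=> k kZ; rewrite !i0 //; apply: e5.
Qed.

Lemma env_run c st : safe c -> env st -> env (run c st).
Proof. by move=> sc; apply: env_frame sc (run_frame c st). Qed.

Lemma env0_frame c st st' :
  all (fun a => a \notin iwr c) [:: 0; 1; 2; 3; 4] ->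
  all (fun a => a \notin nwr c) [:: 0; 1] ->
  frame c st st' -> env0 st -> env0 st'.
Proof.
move=> /allP iw /allP nw [f1 f2] [e1 e2 e3 e4].
have i0 a : a \in [:: 0; 1; 2; 3; 4] -> iarr st' a =1 iarr st a.
  by move=> /iw; apply: f1.
split.
- by move=> i i7; rewrite i0 // e1.
- by rewrite !i0.
- move=> a aw j; rewrite i0 ?e3 //; move: aw; rewrite !inE.
  by case/or4P=> /eqP->.
- by move=> a aw j; rewrite f2 ?e4 // nw.
Qed.

Lemma tables_spec st : (forall a, a \in [:: 10; 11; 12] -> iarr st a 0 = 0) ->
  env0 st -> env (run tables st).
Proof.
move=> T0 E0; have fr := run_frame tables st.
split; first by apply: env0_frame fr E0.
apply: (run_for (P := fun j s => forall k, k <= j ->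
    [/\ iarr s 10 k = k * Z, iarr s 11 k = k * n & iarr s 12 k = k * n'])) => //.
- by case: E0 => _ [].
- by case=> // _; rewrite !mul0n /= /upd /= !T0.
move=> i s iN ci frs Ps k.
have [e1 [e7 _] _ _] : env0 s by apply: env0_frame frs E0.
have [p1 p2 p3] := Ps _ (leqnn i).
rewrite leq_eqVlt => /orP[/eqP->|ki]; last rewrite ltnS in ki.
  by rewrite /= /upd /= ci addn1 !eqxx /= p1 p2 p3 e7 !e1 //= !mulSn; split; lia.
have [q1 q2 q3] := Ps _ ki.
have ki1 : (k == i.+1) = false by rewrite ltn_eqF.
by rewrite /= /upd /= ci addn1 !ki1 /= q1 q2 q3.
Qed.

Section Env.

Variable st : store R.
Hypothesis E : env st.

Lemma env_n : iarr st 0 0 = n. Proof. by case: E => [[H _ _ _] _]; rewrite H. Qed.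
Lemma env_m : iarr st 0 1 = m. Proof. by case: E => [[H _ _ _] _]; rewrite H. Qed.
Lemma env_i : iarr st 0 2 = rk (init A). Proof. by case: E => [[H _ _ _] _]; rewrite H. Qed.
Lemma env_n' : iarr st 0 3 = n'. Proof. by case: E => [[H _ _ _] _]; rewrite H. Qed.
Lemma env_m' : iarr st 0 4 = m'. Proof. by case: E => [[H _ _ _] _]; rewrite H. Qed.
Lemma env_i' : iarr st 0 5 = rk (init A'). Proof. by case: E => [[H _ _ _] _]; rewrite H. Qed.
Lemma env_Sig : iarr st 0 6 = #|Sigma|. Proof. by case: E => [[H _ _ _] _]; rewrite H. Qed.
Lemma env_Z : iarr st 0 7 = Z. Proof. by case: E => [[_ []]]. Qed.
Lemma env_V : iarr st 0 8 = V. Proof. by case: E => [[_ []]]. Qed.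

Lemma env_row k : k <= Z -> iarr st 10 k = k * Z.
Proof. by case: E => _ H /H[]. Qed.
Lemma env_row_n k : k <= Z -> iarr st 11 k = k * n.
Proof. by case: E => _ H /H[]. Qed.
Lemma env_row_n' k : k <= Z -> iarr st 12 k = k * n'.
Proof. by case: E => _ H /H[]. Qed.

Lemma env_src k : k < m -> iarr st 1 k = rk (tr k).1.1.
Proof. by move=> km; case: E => [[_ _ -> // _] _] /=; rewrite (nth_map tr0). Qed.
Lemma env_lab k : k < m -> iarr st 2 k = label_code (inl (tr k).1.2 : Sigma + F).
Proof. by move=> km; case: E => [[_ _ -> // _] _] /=; rewrite (nth_map tr0). Qed.
Lemma env_src' k : k < m' -> iarr st 3 k = rk (tr' k).1.1.
Proof. by move=> km; case: E => [[_ _ -> // _] _] /=; rewrite (nth_map tr0'). Qed.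
Lemma env_lab' k : k < m' -> iarr st 4 k = label_code (tr' k).1.2.
Proof. by move=> km; case: E => [[_ _ -> // _] _] /=; rewrite (nth_map tr0'). Qed.

Lemma env_mu k s : k < m -> narr st 0 (k * n + rk s) = (tr k).2 s.
Proof.
move=> km; case: E => [[_ _ _ -> //] _] /=.
have := @nth_allpairs _ _ _ (fun (t : S * Sigma * dist R S) s => t.2 s) 0%R tr0 s
  (trans A) (enum S) k (rk s) km.
by rewrite -cardE nth_rank => ->.
Qed.
Lemma env_mu' k s : k < m' -> narr st 1 (k * n' + rk s) = (tr' k).2 s.
Proof.
move=> km; case: E => [[_ _ _ -> //] _] /=.
have := @nth_allpairs _ _ _ (fun (t : S' * (Sigma + F) * dist R S') s => t.2 s) 0%R
  tr0' s (trans A') (enum S') k (rk s) km.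
by rewrite -cardE nth_rank => ->.
Qed.

End Env.

Definition code (x : S + S') : nat :=
  match x with inl s => rk s | inr s' => n + rk s' end.

Lemma rk_lt (T : finType) (x : T) : rk x < #|T|. Proof. exact: ltn_ord. Qed.

Lemma code_lt x : code x < V.
Proof. by case: x => [s|s'] /=; rewrite /V ?ltn_add2l ?rk_lt // ltn_addr ?rk_lt. Qed.

Lemma code_eq x y : (code x == code y) = (x == y).
Proof.
case: x y => [s|s'] [t|t'] /=.
- by rewrite rank_eq.
- by rewrite ltn_eqF // ltn_addr ?rk_lt.
- by rewrite gtn_eqF // ltn_addr ?rk_lt.
- by rewrite eqn_add2l rank_eq.
Qed.

Lemma codeP i : i < V -> exists x, code x = i.
Proof.
move=> iV; case: (ltnP i n) => [/rankP[s <-]|ni]; first by exists (inl s).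
have /rankP[s' E] : i - n < n' by move: iV; rewrite /V; lia.
by exists (inr s'); rewrite /= E subnKC.
Qed.

Lemma V_le_Z : V <= Z. Proof. exact: leq_addr. Qed.
Lemma code_ltZ x : code x < Z. Proof. exact: leq_trans (code_lt x) V_le_Z. Qed.
Lemma code_leZ x : code x <= Z. Proof. exact: ltnW (code_ltZ x). Qed.
Lemma rk_ltZ (s : S) : rk s < Z. Proof. exact: code_ltZ (inl s). Qed.
Lemma rk_ltZ' (s : S') : rk s < Z.
Proof. by apply: leq_ltn_trans (code_ltZ (inr s)); apply: leq_addl. Qed.
Lemma m_le_Z : m <= Z. Proof. by rewrite /Z; lia. Qed.
Lemma m'_le_Z : m' <= Z. Proof. by rewrite /Z; lia. Qed.

Lemma code2_eq x y z w :
  (code x * Z + code y == code z * Z + code w) = (x == z) && (y == w).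
Proof. by rewrite addr_inj ?code_ltZ // !code_eq. Qed.

Definition fe st (x : S + S') : R := narr st 2 (code x).
Definition fh st (x : S + S') : nat := iarr st 16 (code x).
Definition fr st (x y : S + S') : R := narr st 3 (code x * Z + code y).

(** * Push-relabel in memory, for one pair of transitions *)

Section Flow.

Variables (M : S -> S' -> bool) (k k' : nat).
Hypotheses (km : k < m) (km' : k' < m').
Local Open Scope ring_scope.

Let mu := (tr k).2.
Let mu' := (tr' k').2.

Definition related st : Prop :=
  forall s s', (iarr st 13 (rk s * Z + rk s')%N == 0%N) = M s s'.

Definition flow_env st : Prop :=
  [/\ env st, iarr st 20 0 = k, iarr st 21 0 = k' & related st].

Definition flow_safe c := safe c && all (fun a => a \notin iwr c) [:: 20; 21; 13]%N.

Lemma flow_env_frame c st st' :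
  flow_safe c -> frame c st st' -> flow_env st -> flow_env st'.
Proof.
case/andP=> sc /allP ac fr' [E e1 e2 e3]; have [f1 _] := fr'; split.
- exact: env_frame sc fr' E.
- by rewrite f1 // ac.
- by rewrite f1 // ac.
- by move=> s s'; rewrite f1 ?e3 // ac.
Qed.

Lemma flow_env_run c st : flow_safe c -> flow_env st -> flow_env (run c st).
Proof. by move=> sc; apply: flow_env_frame sc (run_frame c st). Qed.

Definition net_inv st := pr_inv (supply mu mu') (rcap R M) (fe st) (fh st) (fr st).

Lemma heights_init_spec st : flow_env st ->
  forall x, fh (run heights_init st) x = 0%N.
Proof.
move=> FE x; pose get (s : store R) (p : nat) := iarr s 16 p.
have [E _ _ _] := FE.
have [] // := @run_for1 _ _ get (fun _ _ v => v = 0%N) id 22 8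
  (LIWrite 16 (var 22) (IConst 0)) V st isT.
- exact: env_V.
- by move=> i s iV ci _; rewrite /get /= /upd /= ci eqxx; split=> // p /eqP/negbTE->.
by move=> H _; exact: H (code_lt x).
Qed.

Lemma residuals_init_spec st : flow_env st ->
  forall x y, fr (run residuals_init st) x y = 0.
Proof.
move=> FE x y; pose get (s : store R) (p : nat) := narr s 3 p.
have [E _ _ _] := FE.
have [] // := @run_for2 _ _ get (fun _ _ _ v => v = 0) (fun i j => i * Z + j)%N
  22 8 23 8 (LNWrite 3 (cell (var 22) (var 23)) (NConst 0)) V V st isT isT.
- exact: env_V.
- exact: env_V.
- move=> i j i' j' iV jV i'V j'V /eqP; rewrite addr_inj ?(leq_trans _ V_le_Z) //.
  by case/andP=> /eqP-> /eqP->.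
- move=> i j s iV jV ci cj frs.
  have [Es _ _ _] : flow_env s by apply: flow_env_frame frs FE.
  rewrite /get /= /upd /= ci cj (env_row Es) ?eqxx ?(leq_trans (ltnW iV) V_le_Z) //.
  by split=> // p /eqP/negbTE->.
by move=> H _; apply: H; apply: code_lt.
Qed.

Lemma supplies_init_spec st : flow_env st ->
  forall s, fe (run supplies_init st) (inl s) = mu s.
Proof.
move=> FE s; pose get (s : store R) (p : nat) := narr s 2 p.
have [E _ _ _] := FE.
have [] // := @run_for1 _ _ get (fun i _ v => forall s, rk s = i -> v = mu s) id 22 0
  (LNWrite 2 (var 22) (NRead 0 (IAdd (IRead 11 (var 20)) (var 22)))) n st isT.
- exact: env_n.
- move=> i s' iN ci frs.
  have [Es ck _ _] : flow_env s' by apply: flow_env_frame frs FE.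
  rewrite /get /= /upd /= ci eqxx; split=> [p /eqP/negbTE->//|s0 si].
  by rewrite ck (env_row_n Es) ?(leq_trans (ltnW km) m_le_Z) // -si env_mu.
by move=> H _; apply: H (rk_lt s) _ erefl.
Qed.

Lemma demands_init_spec st : flow_env st ->
  let st' := run demands_init st in
  (forall s, fe st' (inr s) = - mu' s) /\ (forall s, fe st' (inl s) = fe st (inl s)).
Proof.
move=> FE st'; pose get (s : store R) (p : nat) := narr s 2 p.
have [E _ _ _] := FE.
have [] // := @run_for1 _ _ get (fun i _ v => forall s, rk s = i -> v = - mu' s)
  (fun i => n + i)%N 23 3
  (LNWrite 2 (IAdd (par 0) (var 23))
     (NSub (NConst 0) (NRead 1 (IAdd (IRead 12 (var 21)) (var 23))))) n' st isT.
- exact: env_n'.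
- by move=> i j _ _ /eqP; rewrite eqn_add2l => /eqP.
- move=> i s' iN ci frs.
  have [Es _ ck _] : flow_env s' by apply: flow_env_frame frs FE.
  rewrite /get /= /upd /= ci (env_n Es) eqxx; split=> [p /eqP/negbTE->//|s0 si].
  by rewrite ck (env_row_n' Es) ?(leq_trans (ltnW km') m'_le_Z) // -si env_mu' // sub0r.
move=> H1 H2; split=> s; first exact: H1 (rk_lt s) _ erefl.
by apply: H2 => i _ /= E1; have := rk_lt s; rewrite E1 ltnNge leq_addr.
Qed.

Lemma capacities_init_spec st : flow_env st -> (forall x y, fr st x y = 0) ->
  forall x y, fr (run capacities_init st) x y = rcap R M x y.
Proof.
move=> FE fr0 x y; pose get (s : store R) (p : nat) := narr s 3 p.
have [E _ _ _] := FE.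
have [] // := @run_for2 _ _ get
  (fun i j u v => forall s s', rk s = i -> rk s' = j -> v = if M s s' then 1 else u)
  (fun i j => i * Z + (n + j))%N 22 0 23 3 (if_zero (IRead 13 (cell (var 22) (var 23)))
    (LNWrite 3 (cell (var 22) (IAdd (par 0) (var 23))) (NConst 1))) n n' st isT isT.
- exact: env_n.
- exact: env_n'.
- move=> i j i' j' iV jV i'V j'V /eqP.
  rewrite addr_inj ?eqn_add2l; first by case/andP=> /eqP-> /eqP->.
    by apply: leq_trans V_le_Z; rewrite ltn_add2l.
  by apply: leq_trans V_le_Z; rewrite ltn_add2l.
- move=> i j s iV jV ci cj frs.
  have [Es _ _ rel] : flow_env s by apply: flow_env_frame frs FE.
  have iZ : (i <= Z)%N by rewrite (leq_trans _ V_le_Z) // /V; lia.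
  have [s0 si] := rankP iV; have [s0' sj] := rankP jV.
  rewrite -si -sj in iV jV iZ ci cj *.
  rewrite run_if_zero /get /= ci cj (env_row Es) // (env_n Es) rel.
  split=> [p /eqP/negbTE pE|s1 s1' /eqP + /eqP]; first by case: ifP; rewrite /= /upd ?pE.
  rewrite !rank_eq => /eqP-> /eqP->.
  by case: ifP => _; rewrite /= /upd ?ci ?cj ?(env_row Es) ?(env_n Es) ?eqxx.
move=> H1 H2.
(* Only arcs from [S] to [S'] are addressed by the loop; all others keep the 0 from
   [residuals_init]. *)
have off : (forall s s', (x, y) <> (inl s, inr s')) -> fr (run capacities_init st) x y = 0.
  move=> xy; rewrite -(fr0 x y); apply: H2 => i j /rankP[s <-] /rankP[s' <-] /eqP.
  have -> : (rk s * Z + (n + rk s') = code (inl s) * Z + code (inr s'))%N by [].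
  rewrite code2_eq => /andP[/eqP E1 /eqP E2].
  by apply: (xy s s'); rewrite E1 E2.
case: x y off => [s|s] [s'|s'] off; try by rewrite off.
have := H1 _ _ (rk_lt s) (rk_lt s') s s' erefl erefl.
rewrite [get st _](fr0 (inl s) (inr s')) => E1; etransitivity; first exact: E1.
by rewrite /=; case: (M s s').
Qed.

Lemma flow_init_spec st : flow_env st ->
  let st' := run flow_init st in
  [/\ forall x, fe st' x = supply mu mu' x, forall x, fh st' x = 0%N &
     forall x y, fr st' x y = rcap R M x y].
Proof.
move=> F0 st'.
pose s1 := run heights_init st; have F1 : flow_env s1 by apply: flow_env_run.
pose s2 := run residuals_init s1; have F2 : flow_env s2 by apply: flow_env_run.
pose s3 := run supplies_init s2; have F3 : flow_env s3 by apply: flow_env_run.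
pose s4 := run demands_init s3; have F4 : flow_env s4 by apply: flow_env_run.
have fr4 x y : fr s4 x y = 0.
  have [_ f4] := run_frame demands_init s3; have [_ f3] := run_frame supplies_init s2.
  by rewrite /fr f4 // f3 //; apply: residuals_init_spec.
have -> : st' = run capacities_init s4 by [].
have [i5 n5] := run_frame capacities_init s4.
have [dr dl] := demands_init_spec F3.
split=> [x|x|]; last exact: capacities_init_spec.
  rewrite /fe n5 // -/(fe _ _); case: x => s; last exact: dr.
  by rewrite dl; apply: supplies_init_spec.
have [i4 _] := run_frame demands_init s3; have [i3 _] := run_frame supplies_init s2.
have [i2 _] := run_frame residuals_init s1.
by rewrite /fh i5 // i4 // i3 // i2 //; apply: heights_init_spec.
Qed.

Definition amount st x y : R := if fr st x y <= fe st x then fr st x y else fe st x.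

Lemma push_spec st x y : flow_env st ->
  iarr st 22 0 = code x -> iarr st 23 0 = code y -> (x == y) = false ->
  let d := amount st x y in
  (forall z, fe (run push st) z =
     if z == x then fe st z - d else if z == y then fe st z + d else fe st z) /\
  (forall z w, fr (run push st) z w =
     if (z == x) && (w == y) then fr st z w - d
     else if (z == y) && (w == x) then fr st z w + d else fr st z w).
Proof.
move=> [E _ _ _] ci cj xy d; have rowx := env_row E (code_leZ x).
have rowy := env_row E (code_leZ y); have yx : (y == x) = false by rewrite eq_sym.
pose c1 := LIf (NLe (NRead 3 (cell (var 22) (var 23))) (NRead 2 (var 22)))
         (LNWrite 4 (IConst 0) (NRead 3 (cell (var 22) (var 23))))
         (LNWrite 4 (IConst 0) (NRead 2 (var 22))).
pose s1 := run c1 st; have d1 : narr s1 4 0 = d.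
  by rewrite /s1 /c1 /d /amount /fe /fr /= ci cj rowx; case: ifP.
have [i1 n1] := run_frame c1 st.
have n12 : narr s1 2 =1 narr st 2 by apply: n1.
have n13 : narr s1 3 =1 narr st 3 by apply: n1.
have {i1} i1 a : iarr s1 a =1 iarr st a by apply: i1.
(* The [if] denotes the four updates that follow the computation of the amount, without spelling
   them out again. *)
have -> : run push st = run (if push is LSeq _ c2 then c2 else LSkip) s1 by [].
rewrite /=; move: s1 d1 n12 n13 i1 => s1 d1 n12 n13 i1.
split=> [z|z w].
  rewrite /fe /= /upd /= !i1 ci cj !code_eq yx n12 d1.
  by case: eqVneq => [->|_]; [rewrite yx|case: eqVneq => [->|_]]; rewrite ?n12.
rewrite /fr /= /upd /= !i1 ci cj rowx rowy !code2_eq yx xy !n13 d1 /=.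
case: (eqVneq z y) => [->|zy]; rewrite ?yx /=; last by case: ifP => [/andP[/eqP-> /eqP->]|].
by case: eqVneq => [->|].
Qed.

Definition net_pot st := pr_pot (fe st) (fh st) (fr st).

Definition same st st' : Prop :=
  [/\ fe st =1 fe st', fh st =1 fh st' & fr st =2 fr st'].

(** The second alternative demands an unchanged network, not just an equal potential: it is what
    shows that an ineffective sweep met no active node. *)
Definition progress st st' : Prop :=
  net_inv st' /\ ((net_pot st' < net_pot st)%N \/ same st st').

Lemma progress_refl st : net_inv st -> progress st st.
Proof. by move=> I; split=> //; right. Qed.

Lemma progress_eq st st1 st2 : progress st st1 -> same st1 st2 -> progress st st2.
Proof.
case=> I H [e h r]; split; first exact: pr_inv_eq e h r I.
case: H => [lt|[e' h' r']]; [left|right].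
  by rewrite /net_pot -(pr_pot_eq e h r).
by split=> [x|x|x y]; rewrite ?e' ?h' ?r'.
Qed.

Lemma progress_trans st1 st2 st3 :
  progress st1 st2 -> progress st2 st3 -> progress st1 st3.
Proof.
case=> I [lt|[e h r]] [J [lt'|[e' h' r']]]; split=> //.
- by left; apply: ltn_trans lt.
- by left; rewrite /net_pot -(pr_pot_eq e' h' r').
- by left; rewrite /net_pot (pr_pot_eq e h r).
by right; split=> [x|x|x y]; rewrite ?e ?h ?r.
Qed.

Lemma try_push_spec st x y : flow_env st -> net_inv st ->
  iarr st 22 0 = code x -> iarr st 23 0 = code y ->
  let adm := [&& 0 < fe st x, 0 < fr st x y & fh st x == (fh st y).+1] in
  let st' := run try_push st in
  net_inv st' /\
  if adm then [/\ (net_pot st' < net_pot st)%N,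
      (0 < fe st' x -> 0 < fr st' x y -> false),
      (0 < fe st' x -> 0 < fe st x) & forall w, w != y -> fr st' x w = fr st x w]
  else st' = st.
Proof.
move=> FE I ci cj adm st'; have [E _ _ _] := FE.
have -> : st' = if adm then run push st else st.
  rewrite /st' /try_push !run_if_pos run_if_eq /= ci cj (env_row E) ?code_leZ // addn1.
  by rewrite /adm /fe /fr /fh; do 3!case: ifP => //=.
rewrite /adm; case: and3P => [[ex rxy /eqP hxy]|] //.
have xy := push_neq hxy; have [pe pr] := push_spec FE ci cj xy.
have ph z : fh (run push st) z = fh st z by have [i _] := run_frame push st; rewrite /fh i.
set d := amount st x y in pe pr.
have d0 : 0 < d by rewrite /d /amount; case: ifP.
have [de dr] : d <= fe st x /\ d <= fr st x y.
  by rewrite /d /amount; case: (lerP (fr st x y) (fe st x)) => // /ltW.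
have dd : d = fe st x \/ d = fr st x y by rewrite /d /amount; case: ifP; [right|left].
have I' := push_inv I ex rxy hxy (ltW d0) de dr pe pr.
have I2 : net_inv (run push st) by apply: pr_inv_eq I' => // z; rewrite ph.
split=> //; split.
- by rewrite /net_pot -(pr_pot_eq (fun z => erefl) (fun z => esym (ph z)) (fun z w => erefl))
    (push_pot I ex rxy hxy d0 de dr dd pe pr).
- by rewrite pe pr !eqxx /=; case: dd => ->; rewrite subrr ltxx.
- by [].
by move=> w /negbTE wy; rewrite pr wy andbF xy.
Qed.

(** One pass suffices before relabelling: pushes from [x] move no heights and raise no residual
    capacity out of [x], so an arc once found inadmissible remains so. An executed push exhausts
    either its arc or the excess of [x]. *)
Lemma push_all_spec st x : flow_env st -> net_inv st -> iarr st 22 0 = code x ->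
  let st' := run push_all st in
  progress st st' /\
  (0 < fe st' x -> forall y, 0 < fr st' x y -> fh st x <> (fh st y).+1).
Proof.
move=> FE I ci.
pose P i s := progress st s /\ (0 < fe s x -> forall y, (code y < i)%N ->
   0 < fr s x y -> fh st x <> (fh st y).+1).
suff [PN1 PN2] : P V (run push_all st).
  by split=> // ex y; apply: PN2 (code_lt y).
apply: (run_for (P := P)) => //.
- by case: FE => /env_V.
- by split=> //; apply: progress_refl.
move=> i s iV cj frs [Pp Pa]; have [y yi] := codeP iV.
have Fs : flow_env s by apply: flow_env_frame frs FE.
have [fi _] := frs.
have hs z : fh s z = fh st z by rewrite /fh fi.
have [] := try_push_spec (x := x) (y := y) Fs (proj1 Pp); rewrite ?cj ?fi //.
set s' := run try_push s => I'.
pose s2 := seti s' 23 0 i.+1.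
have same2 : same s' s2 by [].
case: ifP => [/and3P[ex rxy hxy] [lt sat _ off]|nadm s's].
  split; first by apply: (progress_eq (st1 := s')) same2; apply: progress_trans Pp _;
    split=> //; left.
  move=> e'x z; rewrite ltnS leq_eqVlt -yi code_eq.
  case: (eqVneq z y) => [->|zy] /= zi rz; first by have := sat e'x rz.
  have {}rz : 0 < fr s x z by rewrite -(off _ zy).
  by apply: (Pa ex) => //; rewrite -yi.
rewrite s's; split; first exact: (progress_eq (st1 := s)).
move=> ex z; rewrite ltnS leq_eqVlt -yi code_eq.
case: (eqVneq z y) => [->|zy] /=; last by rewrite yi; apply: Pa.
by move=> _ rxy hxy; move: nadm; rewrite ex rxy /= !hs hxy eqxx.
Qed.

Definition idle st x : Prop := ~ (0 < fe st x /\ (fh st x <= V)%N).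

Lemma card_nodes : #|{: S + S'}| = V. Proof. exact: card_sum. Qed.

Lemma relabel_spec st x : flow_env st -> net_inv st -> iarr st 22 0 = code x ->
  0 < fe st x -> (fh st x <= V)%N ->
  (forall y, 0 < fr st x y -> fh st x <> (fh st y).+1) ->
  let st' := run relabel st in net_inv st' /\ (net_pot st' < net_pot st)%N.
Proof.
move=> FE I ci ex hx noadm st'.
have h'E z : fh st' z = if z == x then (fh st z).+1 else fh st z.
  rewrite /st' /relabel run_if_pos /= ci -/(fe st x) ex.
  by rewrite /fh /= /upd /= ?ci code_eq addn1; case: eqVneq => [->|].
have [_ nf] := run_frame relabel st.
have eE : fe st =1 fe st' by move=> z; rewrite /fe nf.
have rE : fr st =2 fr st' by move=> z w; rewrite /fr nf.
rewrite -card_nodes in hx; split.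
  by apply: (pr_inv_eq eE (fun z => erefl) rE); apply: relabel_inv I ex hx noadm h'E.
rewrite /net_pot -(pr_pot_eq eE (fun z => erefl) rE).
exact: relabel_pot ex hx h'E.
Qed.

Lemma discharge_spec st x : flow_env st -> net_inv st -> iarr st 22 0 = code x ->
  let st' := run discharge st in
  net_inv st' /\ ((net_pot st' < net_pot st)%N /\ ~ idle st x \/ same st st' /\ idle st x).
Proof.
move=> FE I ci st'; have [E _ _ _] := FE.
have -> : st' = if (fh st x <= V)%N && (0 < fe st x)
                then run relabel (run push_all st) else st.
  have -> : st' = if (iarr st 16 (iarr st 22 0) <= iarr st 0 8)%N
      then run (if_pos (NRead 2 (var 22)) (LSeq push_all relabel)) st else st by [].
  rewrite run_if_pos -[neval _ _]/(narr st 2 (iarr st 22 0)) ci (env_V E).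
  by rewrite -/(fe st x) -/(fh st x); case: ifP.
case: andP => [[hx ex]|nidle]; last first.
  by split=> //; right; split=> // -[? ?]; apply: nidle.
have nid : ~ idle st x by move=> /(_ (conj ex hx)).
have [Pr noadm] := push_all_spec FE I ci.
set s1 := run push_all st in Pr noadm *.
have [i1 _] := run_frame push_all st.
have h1 z : fh s1 z = fh st z by rewrite /fh i1.
have F1 : flow_env s1 by apply: flow_env_run.
have c1 : iarr s1 22 0 = code x by rewrite i1.
have [I1 P1] := Pr.
have le1 : (net_pot s1 <= net_pot st)%N.
  by case: P1 => [/ltnW //|[e h r]]; rewrite /net_pot (pr_pot_eq e h r).
case ex1: (0 < fe s1 x).
  have [||I2 P2] := relabel_spec F1 I1 c1 ex1; rewrite ?h1 //.
    by move=> y; rewrite h1; apply: noadm.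
  by split=> //; left; split=> //; apply: leq_trans le1.
have -> : run relabel s1 = s1 by rewrite /relabel run_if_pos /= c1 -/(fe s1 x) ex1.
(* Here the pushes used up the excess of [x], so the network cannot be unchanged. *)
split=> //; case: P1 => [|[e _ _]]; first by left.
by move: ex1; rewrite -e ex.
Qed.

Lemma sweep_spec st : flow_env st -> net_inv st ->
  let st' := run sweep st in
  net_inv st' /\ ((net_pot st' < net_pot st)%N /\ ~ (forall x, idle st x) \/
                  same st st' /\ forall x, idle st x).
Proof.
move=> FE I.
pose P i s := net_inv s /\ ((net_pot s < net_pot st)%N /\ ~ (forall x, idle st x) \/
  same st s /\ forall x, (code x < i)%N -> idle st x).
suff [? [?|[? PN]]] : P V (run sweep st).
- by split=> //; left.
- by split=> //; right; split=> // x; apply: PN (code_lt x).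
apply: (run_for (P := P)) => //.
- by case: FE => /env_V.
- by split=> //; right.
move=> i s iV ci frs [Is Ps]; have [x xi] := codeP iV.
have Fs : flow_env s by apply: flow_env_frame frs FE.
have [] := discharge_spec (x := x) Fs Is; rewrite ?ci //.
set s' := run discharge s => I' P'.
split=> //; case: Ps => [[lt nid]|[[e h r] id]].
  left; split=> //; case: P' => [[lt' _]|[[e' h' r'] _]]; first exact: ltn_trans lt.
  by rewrite /net_pot -(pr_pot_eq e' h' r').
case: P' => [[lt' nid]|[[e' h' r'] id']].
  left; rewrite /net_pot (pr_pot_eq e h r); split=> // idst; apply: nid.
  by rewrite /idle -e -h; apply: idst.
right; split; first by split=> [z|z|z w]; rewrite ?e ?h ?r ?e' ?h' ?r'.
move=> z; rewrite ltnS leq_eqVlt -xi code_eq => /orP[/eqP->|].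
  by rewrite /idle e h.
by rewrite xi; apply: id.
Qed.

(** As long as some node is active, each sweep costs one unit of potential, so potential plus sweeps
    made stays below [Z ^ 5]. After [Z ^ 5] sweeps this is impossible, and idleness persists once
    reached. *)
Lemma flow_loop_spec st : flow_env st -> net_inv st ->
  let st' := run flow_loop st in net_inv st' /\ forall x, idle st' x.
Proof.
move=> FE I.
pose Q j s := net_inv s /\ ((forall x, idle s x) \/ (net_pot s + j < Z ^ 5)%N).
have Q1 j s : flow_env s -> Q j s -> Q (j + 1)%N (run sweep s).
  move=> Fs [Is Ps]; have [I' P'] := sweep_spec Fs Is; split=> //.
  case: P' => [[lt nid]|[[e h r] id]]; last by left=> x; rewrite /idle -e -h; apply: id.
  by case: Ps => [//|lt']; right; lia.
have nest a c d : (forall j s, flow_env s -> Q j s -> Q (j + d)%N (run c s)) ->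
    flow_safe (LFor a 7 c) -> loopable a c ->
    (forall j s v, Q j s -> Q j (seti s a 0 v)) ->
    forall j s, flow_env s -> Q j s -> Q (j + Z * d)%N (run (LFor a 7 c) s).
  move=> Qc fs wl st_a j s Fs Qj; apply: (@run_rep _ flow_env Q a 7 c d Z) => //.
  - by case: Fs => /env_Z.
  - by move=> s' fr'; exact: flow_env_frame fs fr' Fs.
have Q2 := nest 28%N _ _ Q1 isT isT (fun _ _ _ => id).
have Q3 := nest 27%N _ _ Q2 isT isT (fun _ _ _ => id).
have Q4 := nest 26%N _ _ Q3 isT isT (fun _ _ _ => id).
have Q5 := nest 25%N _ _ Q4 isT isT (fun _ _ _ => id).
have Q6 := nest 24%N _ _ Q5 isT isT (fun _ _ _ => id).
have [|? [//|]] := Q6 0%N st FE.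
  split=> //; right; rewrite addn0.
  (* The comparison with [Z ^ 5] is strict because [k < m] makes [Z] larger than [V + 3]. *)
  apply: leq_ltn_trans (pr_pot_bound I) _.
  by rewrite ltn_exp2r // card_nodes /Z /V; lia.
by rewrite muln1 !expnS expn0 muln1 ltnNge leq_addl.
Qed.

Lemma flow_check_spec st : flow_env st -> net_inv st -> (forall x, idle st x) ->
  let st' := run flow_check st in
  [/\ forall p, p != (k * Z + k')%N -> iarr st' 14 p = iarr st 14 p
    & iarr st' 14 (k * Z + k')%N = 0%N <-> lift_rel M mu mu'].
Proof.
move=> FE I id st'; have [E ck ck' _] := FE.
have kZ : (k <= Z)%N by apply: leq_trans (ltnW km) m_le_Z.
pose s1 := run (LIWrite 14 (cell (var 20) (var 21)) (IConst 0)) st.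
have F1 : flow_env s1 by apply: flow_env_run.
have s1E p : iarr s1 14 p = if p == (k * Z + k')%N then 0%N else iarr st 14 p.
  by rewrite /s1 /= /upd /= ck ck' (env_row E).
have flag p : iarr st' 14 p =
   if has (fun i => (p == (k * Z + k')%N) && (0 < narr st 2 i)) (iota 0 V)
   then 1%N else iarr s1 14 p.
  have -> : st' = run (LFor 22 8 (if_pos (NRead 2 (var 22))
    (LIWrite 14 (cell (var 20) (var 21)) (IConst 1)))) s1 by [].
  apply: run_for_flag => //; first by case: F1 => /env_V.
  move=> i s iV ci frs; have [Es ck1 ck1' _] : flow_env s by apply: flow_env_frame frs F1.
  have [_ nf] := frs; rewrite run_if_pos /= ci nf //=.
  rewrite (fun_if (fun s => iarr s 14 p)) /= /upd /= ck1 ck1' (env_row Es) //.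
  by case: (p == _); case: (0 < _).
split=> [p /negbTE pk|].
  rewrite flag s1E pk (_ : has _ _ = false) //.
  by apply/hasPn.
rewrite flag s1E eqxx /=; case: hasP => [[i]|nh].
  rewrite mem_iota add0n => /codeP[x <-] ex; split=> // L; exfalso.
  apply: (pr_infeasible I ex _ L).
  by rewrite card_nodes ltnNge; apply/negP => hx; apply: (id x).
split=> // _; apply: (pr_feasible I) => x; rewrite leNgt; apply/negP => ex.
by apply: nh; exists (code x); rewrite // mem_iota add0n code_lt.
Qed.

Lemma flow_body_spec st : flow_env st ->
  let st' := run flow_body st in
  (forall p, p != (k * Z + k')%N -> iarr st' 14 p = iarr st 14 p) /\
  (iarr st' 14 (k * Z + k')%N = 0%N <-> lift_rel M mu mu').
Proof.
move=> FE st'.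
pose s1 := run flow_init st; have F1 : flow_env s1 by apply: flow_env_run.
pose s2 := run flow_loop s1; have F2 : flow_env s2 by apply: flow_env_run.
have [e1 h1 r1] := flow_init_spec FE.
have I1 : net_inv s1.
  apply: pr_inv_eq (pr_inv_init (supply mu mu') (@rcap_ge0 R _ _ M)).
  - by move=> x; rewrite e1.
  - by move=> x; rewrite h1.
  - by move=> x y; rewrite r1.
have [I2 id2] := flow_loop_spec F1 I1.
have [C1 C2] := flow_check_spec F2 I2 id2; split=> // p pk.
have [i1 _] := run_frame flow_init st; have [i2 _] := run_frame flow_loop s1.
by etransitivity; [exact: C1|rewrite i2 // i1].
Qed.

End Flow.

(** * The tables of related distributions *)

Definition lift_ok (M : S -> S' -> bool) st : Prop :=
  forall k k', k < m -> k' < m' ->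
    iarr st 14 (k * Z + k') = 0 <-> lift_rel M (tr k).2 (tr' k').2.

Lemma lift_phase_spec (M : S -> S' -> bool) st :
  env st -> related M st -> lift_ok M (run lift_phase st).
Proof.
move=> E rel; pose get (s : store R) (p : nat) := iarr s 14 p.
have [] // := @run_for2 _ _ get
  (fun k k' _ v => v = 0 <-> lift_rel M (tr k).2 (tr' k').2)
  (fun i j => i * Z + j) 20 1 21 4 flow_body m m' st isT isT.
- exact: env_m.
- exact: env_m'.
- move=> i j i' j' _ jm _ j'm /eqP.
  by rewrite addr_inj ?(leq_trans _ m'_le_Z) // => /andP[/eqP-> /eqP->].
- move=> k k' s km km' ck ck' frs.
  have FE : flow_env M k k' s.
    split=> //; first exact: env_frame frs E.
    by move=> t t'; have [fi _] := frs; rewrite fi.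
  have [H1 H2] := flow_body_spec km km' FE.
  by split=> // p /eqP; apply: H1.
Qed.

(** A coupling with a Dirac distribution is forced: all its mass lies in the row of [s]. Fault
    transitions therefore need only a support test and no flow. *)
Lemma lift_dirac (M : S -> S' -> bool) (s : S) (nu : dist R S') :
  lift_rel M (dirac R s) nu <-> (forall t', (0 < nu t')%R -> M s t').
Proof.
split=> [[w [wl wr] wM] t' nt'|nuM].
  have w0 p : (0 <= w p)%R by apply: dist_ge0.
  rewrite -wr lt0r psumr_neq0 // in nt'.
  have /andP[/hasP[t _ /= wt] _] := nt'.
  have [<-|ts] := eqVneq t s; first exact: wM.
  have : (0 < dirac R s t)%R.
    rewrite -wl (bigD1 t') //= ltr_pwDl // sumr_ge0 //.
  by rewrite /= ffunE (negbTE ts) ltxx.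
pose w : {ffun S * S' -> R} := [ffun p => if p.1 == s then nu p.2 else 0%R].
have wl t : (\sum_t' w (t, t') = dirac R s t)%R.
  rewrite /= ffunE; under eq_bigr do rewrite ffunE /=.
  by case: (t == s); rewrite ?dist_sum ?big1.
have wr t' : (\sum_t w (t, t') = nu t')%R.
  under eq_bigr do rewrite ffunE /=.
  by rewrite -big_mkcond big_pred1_eq.
have wd : is_dist w.
  apply/andP; split.
    by apply/forallP => p; rewrite ffunE; case: ifP => // _; apply: dist_ge0.
  rewrite (eq_bigr (fun p => w (p.1, p.2))) => [|[]//].
  rewrite -(pair_bigA _ (fun s s' => w (s, s'))) /=.
  by rewrite (eq_bigr _ (fun s _ => wl s)) dist_sum.
exists (Dist wd) => [|t t']; first by split.
by rewrite /= ffunE /=; case: eqP => [->|]; [apply: nuM|rewrite ltxx].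
Qed.

Definition dirac_ok (M : S -> S' -> bool) st : Prop :=
  forall s k', k' < m' ->
    iarr st 15 (rk s * Z + k') = 0 <-> lift_rel M (dirac R s) (tr' k').2.

Lemma dirac_body_spec (M : S -> S' -> bool) s k' st : k' < m' ->
  env st -> related M st -> iarr st 31 0 = rk s -> iarr st 21 0 = k' ->
  let st' := run dirac_body st in
  (forall p, p != rk s * Z + k' -> iarr st' 15 p = iarr st 15 p) /\
  (iarr st' 15 (rk s * Z + k') = 0 <-> lift_rel M (dirac R s) (tr' k').2).
Proof.
move=> km' E rel cs ck' st'; have sZ := ltnW (rk_ltZ s).
pose c0 := LIWrite 15 (cell (var 31) (var 21)) (IConst 0).
pose s1 := run c0 st.
have s1E p : iarr s1 15 p = if p == rk s * Z + k' then 0 else iarr st 15 p.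
  by rewrite /s1 /= /upd /= cs ck' (env_row E).
pose c := if_nzero (IRead 13 (cell (var 31) (var 23)))
      (if_pos (NRead 1 (IAdd (IRead 12 (var 21)) (var 23)))
         (LIWrite 15 (cell (var 31) (var 21)) (IConst 1))).
have E1 : env s1 by apply: env_run.
have flag p : iarr st' 15 p =
   if has (fun j => [&& p == rk s * Z + k', iarr st 13 (rk s * Z + j) != 0 &
       (0 < narr st 1 (k' * n' + j))%R]) (iota 0 n')
   then 1 else iarr s1 15 p.
  have -> : st' = run (LFor 23 3 c) s1 by [].
  apply: run_for_flag => //; first exact: env_n'.
  move=> j s2 jn cj frs; have E2 : env s2 by apply: env_frame frs E1.
  have [fi fn] := frs.
  have cs2 : iarr s2 31 0 = rk s by rewrite fi.
  have ck2 : iarr s2 21 0 = k' by rewrite fi.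
  rewrite /c run_if_nzero run_if_pos /= cs2 cj ck2 (env_row E2) //.
  rewrite (env_row_n' E2) ?(leq_trans (ltnW km') m'_le_Z) // fi // fn //.
  rewrite -[iarr s1 13 _]/(iarr st 13 _) -[narr s1 1 _]/(narr st 1 _).
  case: (iarr st 13 _ == 0); rewrite /= ?andbF //.
  by case: (0 < _)%R; rewrite ?andbF ?andbT.
split=> [p /negbTE pk|].
  rewrite flag s1E pk (_ : has _ _ = false) //.
  by apply/hasPn.
rewrite flag s1E eqxx lift_dirac /=; case: hasP => [[j]|nh].
  rewrite mem_iota add0n => /rankP[t' <-] /andP[Mst'].
  by rewrite env_mu' // => nut'; split=> // /(_ _ nut'); rewrite -rel (negbTE Mst').
split=> // _ t' nut'; rewrite -rel; apply/negPn/negP => Mst'.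
by apply: nh; exists (rk t'); rewrite ?mem_iota ?rk_lt ?env_mu' ?Mst'.
Qed.

Lemma dirac_phase_spec (M : S -> S' -> bool) st :
  env st -> related M st -> dirac_ok M (run dirac_phase st).
Proof.
move=> E rel; pose get (s : store R) (p : nat) := iarr s 15 p.
have [] // := @run_for2 _ _ get
  (fun i k' _ v => forall s, rk s = i -> v = 0 <-> lift_rel M (dirac R s) (tr' k').2)
  (fun i j => i * Z + j) 31 0 21 4 dirac_body n m' st isT isT.
- exact: env_n.
- exact: env_m'.
- move=> i j i' j' _ jm _ j'm /eqP.
  by rewrite addr_inj ?(leq_trans _ m'_le_Z) // => /andP[/eqP-> /eqP->].
- move=> i k' s1 iN km' ck ck' frs; have [s si] := rankP iN.
  rewrite -si in iN ck *.
  have rel1 : related M s1 by move=> t t'; have [fi _] := frs; rewrite fi.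
  have E1 : env s1 by apply: env_frame frs E.
  have [H1 H2] := dirac_body_spec km' E1 rel1 ck ck'.
  split=> [p /eqP|t /eqP]; first exact: H1.
  by rewrite rank_eq => /eqP->.
by move=> H _ s k' km'; apply: H (rk_lt s) km' s erefl.
Qed.

Lemma label_code_eq (l l' : Sigma + F) : (label_code l == label_code l') = (l == l').
Proof.
case: l l' => [e|f] [e'|f'] /=.
- by rewrite rank_eq.
- by rewrite ltn_eqF // ltn_addr ?rk_lt.
- by rewrite gtn_eqF // ltn_addr ?rk_lt.
- by rewrite eqn_add2l rank_eq.
Qed.

(** * Testing the three clauses for one pair of states *)

Section Refine.

Variables (L D : nat -> nat -> bool) (s : S) (s' : S').

Definition refine_env st : Prop :=
  [/\ env st, iarr st 31 0 = rk s /\ iarr st 32 0 = rk s',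
   forall k k', k < m -> k' < m' -> (iarr st 14 (k * Z + k') == 0) = L k k' &
   forall k', k' < m' -> (iarr st 15 (rk s * Z + k') == 0) = D (rk s) k'].

Definition refine_safe c := safe c && all (fun a => a \notin iwr c) [:: 31; 32; 14; 15].

Lemma refine_env_frame c st st' :
  refine_safe c -> frame c st st' -> refine_env st -> refine_env st'.
Proof.
case/andP=> sc /allP ac fr' [E [e1 e2] e3 e4]; have [f1 _] := fr'; split.
- exact: env_frame sc fr' E.
- by rewrite !f1 ?ac.
- by move=> k k' km km'; rewrite f1 ?e3 ?ac.
- by move=> k' km'; rewrite f1 ?e4 ?ac.
Qed.

Lemma refine_env_run c st : refine_safe c -> refine_env st -> refine_env (run c st).
Proof. by move=> sc; apply: refine_env_frame sc (run_frame c st). Qed.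

Definition matched k k' : bool := (inl (tr k).1.2 == (tr' k').1.2) && L k k'.

Lemma match_pair_spec k k' st : k < m -> k' < m' -> refine_env st ->
  iarr st 20 0 = k -> iarr st 21 0 = k' ->
  iarr (run match_pair st) 18 0 = if matched k k' then 0 else iarr st 18 0.
Proof.
move=> km km' [E _ HL _] ck ck'.
rewrite /match_pair run_if_eq run_if_zero /= ck ck' (env_lab E) // (env_lab' E) //.
rewrite (env_row E) ?(leq_trans (ltnW km) m_le_Z) // HL // label_code_eq /matched.
by case: (_ == _); case: (L _ _).
Qed.

Definition left_fails k : bool :=
  ((tr k).1.1 == s) &&
  ~~ has (fun k' => ((tr' k').1.1 == s') && matched k k') (iota 0 m').

Definition right_fails k' : bool :=
  ((tr' k').1.1 == s') &&
  if (tr' k').1.2 is inl _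
  then ~~ has (fun k => ((tr k).1.1 == s) && matched k k') (iota 0 m)
  else ~~ D (rk s) k'.

Lemma fail_if_unmatched_spec st :
  iarr (run fail_if_unmatched st) 17 0 = if iarr st 18 0 == 0 then iarr st 17 0 else 1.
Proof. by rewrite /fail_if_unmatched run_if_nzero /=; case: ifP. Qed.

Lemma match_left_spec st : refine_env st ->
  iarr (run match_left st) 17 0 =
  if has left_fails (iota 0 m) then 1 else iarr st 17 0.
Proof.
move=> E0; apply: run_for_flag => //; first by case: E0 => /env_m.
move=> k st1 km ck fr1; have E1 : refine_env st1 by apply: refine_env_frame fr1 E0.
have [E [cs cs'] _ _] := E1.
rewrite run_if_eq [ieval _ _]/= [X in _ == X]/= ck cs (env_src E) // rank_eq /left_fails.
case: eqP => //= _.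
pose st2 := run (LIWrite 18 (IConst 0) (IConst 1)) st1.
have E2 : refine_env st2 by apply: refine_env_run.
pose c3 := LFor 21 4 (if_eq (IRead 3 (var 21)) (var 32) match_pair).
have f3 : iarr (run c3 st2) 18 0 =
   if has (fun k' => ((tr' k').1.1 == s') && matched k k') (iota 0 m')
   then 0 else iarr st2 18 0.
  apply: run_for_flag => //; first by case: E2 => /env_m'.
  move=> k' st3 km' ck' fr3.
  have E3 : refine_env st3 by apply: refine_env_frame fr3 E2.
  have [E' [_ cs3] _ _] := E3; have [fi _] := fr3.
  rewrite run_if_eq [ieval _ _]/= [X in _ == X]/= ck' cs3 (env_src' E') // rank_eq.
  by case: eqP => //= _; apply: match_pair_spec => //; rewrite fi.
rewrite -/(run c3 st2) -/(run fail_if_unmatched _) fail_if_unmatched_spec f3.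
have [fi _] := run_frame c3 st2; rewrite fi //.
by case: has.
Qed.

Lemma match_right_spec st : refine_env st ->
  iarr (run match_right st) 17 0 =
  if has right_fails (iota 0 m') then 1 else iarr st 17 0.
Proof.
move=> E0; apply: run_for_flag => //; first by case: E0 => /env_m'.
move=> k' st1 km' ck' fr1; have E1 : refine_env st1 by apply: refine_env_frame fr1 E0.
have [E [cs cs'] _ HD] := E1.
rewrite run_if_eq [ieval _ _]/= [X in _ == X]/= ck' cs' (env_src' E) // rank_eq /right_fails.
case: eqP => //= _.
rewrite ck' (env_Sig E) (env_lab' E) //.
case: (tr' k').1.2 => [e|f] /=; last first.
  rewrite leq_addr cs (env_row E) ?(ltnW (rk_ltZ s)) // leqn0 HD //.
  by case: (D _ _).
rewrite leqNgt rk_lt /=.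
pose st2 := run (LIWrite 18 (IConst 0) (IConst 1)) st1.
have E2 : refine_env st2 by apply: refine_env_run.
pose c3 := LFor 20 1 (if_eq (IRead 1 (var 20)) (var 31) match_pair).
have f3 : iarr (run c3 st2) 18 0 =
   if has (fun k => ((tr k).1.1 == s) && matched k k') (iota 0 m)
   then 0 else iarr st2 18 0.
  apply: run_for_flag => //; first by case: E2 => /env_m.
  move=> k st3 km ck fr3.
  have E3 : refine_env st3 by apply: refine_env_frame fr3 E2.
  have [E' [cs3 _] _ _] := E3; have [fi _] := fr3.
  rewrite run_if_eq [ieval _ _]/= [X in _ == X]/= ck cs3 (env_src E') // rank_eq.
  by case: eqP => //= _; apply: match_pair_spec => //; rewrite fi.
rewrite -/(run c3 st2) -/(run fail_if_unmatched _) fail_if_unmatched_spec f3.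
have [fi _] := run_frame c3 st2; rewrite fi //.
by case: has.
Qed.

Lemma refine_body_spec st : refine_env st ->
  let st' := run refine_body st in
  (forall p, p != rk s * Z + rk s' -> iarr st' 13 p = iarr st 13 p) /\
  (iarr st' 13 (rk s * Z + rk s') == 0) =
  [&& iarr st 13 (rk s * Z + rk s') == 0, ~~ has left_fails (iota 0 m)
    & ~~ has right_fails (iota 0 m')].
Proof.
move=> E0 st'.
pose st1 := run (LIWrite 17 (IConst 0) (IConst 0)) st.
have E1 : refine_env st1 by apply: refine_env_run.
pose st2 := run match_left st1; have E2 : refine_env st2 by apply: refine_env_run.
pose st3 := run match_right st2; have E3 : refine_env st3 by apply: refine_env_run.
have -> : st' = run (if_nzero (var 17) (LIWrite 13 (cell (var 31) (var 32)) (IConst 1))) st3.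
  by [].
have M3 p : iarr st3 13 p = iarr st 13 p.
  have [i2 _] := run_frame match_left st1; have [i3 _] := run_frame match_right st2.
  by rewrite i3 // i2.
have [E [cs cs'] _ _] := E3.
rewrite run_if_nzero [ieval _ _]/=.
have -> : (iarr st3 17 0 == 0) = ~~ has left_fails (iota 0 m) && ~~ has right_fails (iota 0 m').
  rewrite match_right_spec // match_left_spec //.
  by case: has; case: has.
case: ifP => _; first by split=> [p _|]; rewrite !M3 ?andbT.
split=> [p /negbTE|]; rewrite /= /upd /= cs cs' (env_row E) ?(ltnW (rk_ltZ s)) //.
  by move=> ->; apply: M3.
by rewrite eqxx andbF.
Qed.

End Refine.

Definition masking_step (M : S -> S' -> Prop) (s : S) (s' : S') : Prop :=
  [/\ forall (e : Sigma) mu, (s, e, mu) \in trans A ->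
        exists2 mu', (s', inl e, mu') \in trans A' & lift_rel M mu mu',
      forall (e : Sigma) mu', (s', inl e, mu') \in trans A' ->
        exists2 mu, (s, e, mu) \in trans A & lift_rel M mu mu' &
      forall (f : F) mu', (s', inr f, mu') \in trans A' ->
        lift_rel M (dirac R s) mu'].

Lemma lift_rel_mono (M N : S -> S' -> Prop) (mu : dist R S) (mu' : dist R S') :
  (forall s s', M s s' -> N s s') -> lift_rel M mu mu' -> lift_rel N mu mu'.
Proof. by move=> MN [w cw wM]; exists w => // t t' /wM/MN. Qed.

(** Monotonicity makes the iteration a descent to the greatest fixed point: a masking relation below
    [M] is also below the refinement of [M]. *)
Lemma masking_step_mono (M N : S -> S' -> Prop) s s' :
  (forall s s', M s s' -> N s s') -> masking_step M s s' -> masking_step N s s'.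
Proof.
move=> MN [c1 c2 c3]; split=> [e mu /c1[mu' ? ?]|e mu' /c2[mu ? ?]|f mu' /c3].
- by exists mu' => //; apply: lift_rel_mono MN _.
- by exists mu => //; apply: lift_rel_mono MN _.
exact: lift_rel_mono.
Qed.

Lemma trP x : reflect (exists2 k, k < m & tr k = x) (x \in trans A).
Proof. exact: nthP. Qed.

Lemma trP' x : reflect (exists2 k, k < m' & tr' k = x) (x \in trans A').
Proof. exact: nthP. Qed.

Lemma tr_mem k : k < m -> ((tr k).1.1, (tr k).1.2, (tr k).2) \in trans A.
Proof. by move=> km; apply/trP; exists k => //; case: (tr k) => -[]. Qed.

Lemma tr_mem' k : k < m' -> ((tr' k).1.1, (tr' k).1.2, (tr' k).2) \in trans A'.
Proof. by move=> km; apply/trP'; exists k => //; case: (tr' k) => -[]. Qed.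

(** Passes from transition numbers, over which the program searches, to the transitions
    themselves. *)
Lemma no_failsP (M : S -> S' -> bool) (L D : nat -> nat -> bool) s s' :
  (forall k k', k < m -> k' < m' -> L k k' <-> lift_rel M (tr k).2 (tr' k').2) ->
  (forall k', k' < m' -> D (rk s) k' <-> lift_rel M (dirac R s) (tr' k').2) ->
  ~~ has (left_fails L s s') (iota 0 m) && ~~ has (right_fails L D s s') (iota 0 m') <->
  masking_step M s s'.
Proof.
move=> HL HD; split=> [/andP[/hasPn nl /hasPn nr]|[c1 c2 c3]].
  split=> [e mu /trP[k km E]|e mu' /trP'[k' km E]|f mu' /trP'[k' km E]].
  - have := nl k; rewrite mem_iota add0n km => /(_ isT).
    rewrite /left_fails E eqxx /= negbK => /hasP[k'].
    rewrite mem_iota add0n => km' /and3P[/eqP E1 /eqP E2 Lk].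
    exists (tr' k').2; last by have := HL _ _ km km'; rewrite E => <-.
    by have := tr_mem' km'; rewrite E1 -E2 E.
  - have := nr k'; rewrite mem_iota add0n km => /(_ isT).
    rewrite /right_fails E eqxx /= negbK => /hasP[k].
    rewrite mem_iota add0n => km' /and3P[/eqP E1 /eqP E2 Lk].
    exists (tr k).2; last by have := HL _ _ km' km; rewrite E => <-.
    by have := tr_mem km'; rewrite E1; move: E2; rewrite E => -[->].
  have := nr k'; rewrite mem_iota add0n km => /(_ isT).
  rewrite /right_fails E eqxx /= negbK => Dk.
  by have := HD _ km; rewrite E => <-.
apply/andP; split; apply/hasPn => k; rewrite mem_iota add0n => km.
  apply/nandP; case: eqP => [E1|_]; [right|by left]; rewrite negbK.
  have := tr_mem km; rewrite E1 => /c1[mu' /trP'[k' km' E'] lk].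
  apply/hasP; exists k'; first by rewrite mem_iota.
  by rewrite /matched E' !eqxx /=; apply/(HL _ _ km km'); rewrite E'.
apply/nandP; case: eqP => [E1|_]; [right|by left].
have := tr_mem' km; rewrite E1; case El: (tr' k).1.2 => [e|f]; rewrite negbK.
  move=> /c2[mu /trP[k' km' E'] lk].
  apply/hasP; exists k'; first by rewrite mem_iota.
  by rewrite /matched El E' !eqxx /=; apply/(HL _ _ km' km); rewrite E'.
by move/c3 => lk; apply/HD.
Qed.

Lemma round_spec (M : S -> S' -> bool) st : env st -> related M st ->
  exists2 M' : S -> S' -> bool, related M' (run round st) &
    forall s s', M' s s' <-> M s s' /\ masking_step M s s'.
Proof.
move=> E rel.
pose st1 := run lift_phase st; pose st2 := run dirac_phase st1.
have E1 : env st1 by apply: env_run. have E2 : env st2 by apply: env_run.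
have rel1 : related M st1.
  by move=> s s'; have [i _] := run_frame lift_phase st; rewrite i.
have rel2 : related M st2.
  by move=> s s'; have [i _] := run_frame dirac_phase st1; rewrite i.
pose L k k' := iarr st2 14 (k * Z + k') == 0.
pose D i k' := iarr st2 15 (i * Z + k') == 0.
have HL k k' : k < m -> k' < m' -> L k k' <-> lift_rel M (tr k).2 (tr' k').2.
  move=> km km'; have := lift_phase_spec E rel km km'.
  have [i _] := run_frame dirac_phase st1; rewrite /L i // => <-.
  by split=> /eqP.
have HD s k' : k' < m' -> D (rk s) k' <-> lift_rel M (dirac R s) (tr' k').2.
  move=> km'; rewrite -(dirac_phase_spec E1 rel1 s km').
  by split=> /eqP.
exists (fun s s' => iarr (run round st) 13 (rk s * Z + rk s') == 0) => // s s'.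
rewrite -(no_failsP s' HL (HD s)).
pose get (s : store R) (p : nat) := iarr s 13 p.
have [] // := @run_for2 _ _ get
  (fun i j u v => forall s s', rk s = i -> rk s' = j -> (v == 0) =
    [&& u == 0, ~~ has (left_fails L s s') (iota 0 m)
      & ~~ has (right_fails L D s s') (iota 0 m')])
  (fun i j => i * Z + j) 31 0 32 3 refine_body n n' st2 isT isT.
- exact: env_n.
- exact: env_n'.
- move=> i j i' j' _ /rankP[t <-] _ /rankP[t' <-] /eqP.
  by rewrite addr_inj ?rk_ltZ' // => /andP[/eqP-> /eqP->].
- move=> i j st3 /rankP[t <-] /rankP[t' <-] ci cj frs; have [fi _] := frs.
  have E3 : refine_env L D t t' st3.
    split=> //; first exact: env_frame frs E2.
      by move=> k k' _ _; rewrite fi.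
    by move=> k' _; rewrite fi.
  have [B1 B2] := refine_body_spec E3; split=> [p /eqP|u u' /eqP + /eqP]; first exact: B1.
  by rewrite !rank_eq => /eqP-> /eqP->.
move=> /(_ _ _ (rk_lt s) (rk_lt s') s s' erefl erefl) H _.
have -> : (iarr (run round st) 13 (rk s * Z + rk s') == 0) =
  [&& M s s', ~~ has (left_fails L s s') (iota 0 m)
      & ~~ has (right_fails L D s s') (iota 0 m')] by rewrite -rel2; exact: H.
by split=> /andP.
Qed.

(* Each round removes a pair or has reached a fixed point, and there are
   |S| |S'| rounds. *)
Definition rounds_inv (j : nat) st : Prop := exists M : S -> S' -> bool,
  [/\ related M st,
    forall N, is_masking A A' N -> forall s s', N s s' -> M s s' &
    (forall s s', M s s' -> masking_step M s s') \/
    #|[set p : S * S' | M p.1 p.2]| + j <= n * n'].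

Lemma round_inv j st : env st -> rounds_inv j st -> rounds_inv (j + 1) (run round st).
Proof.
move=> E [M [rel up fin]]; have [M' rel' M'E] := round_spec E rel.
have M'M s s' : M' s s' -> M s s' by rewrite M'E => -[].
exists M'; split=> //.
  move=> N maskN s s' Nss'; rewrite M'E; split; first exact: up Nss'.
  by apply: masking_step_mono (up N maskN) _; apply: (proj2 maskN).
have sub : [set p : S * S' | M' p.1 p.2] \subset [set p | M p.1 p.2].
  by apply/subsetP => p; rewrite !inE; apply: M'M.
(* If nothing was deleted, the relation is a fixed point. Otherwise it was not one before, and the
   cardinality drops, which pays for the round. *)
case: (boolP ([set p : S * S' | M p.1 p.2] \subset [set p | M' p.1 p.2])) => [sub'|nsub].
  have MM' s s' : M s s' -> M' s s'.
    by move=> Mss'; have /subsetP/(_ (s, s')) := sub'; rewrite !inE; apply.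
  left=> s s'; rewrite M'E => -[_]; apply: masking_step_mono; exact: MM'.
case: fin => [fix_M|le].
  case/negP: nsub; apply/subsetP => -[s s']; rewrite !inE /= => Mss'.
  by rewrite M'E; split=> //; apply: fix_M.
right; apply: leq_trans le; rewrite addn1 addnS -addSn leq_add2r.
by apply: proper_card; rewrite properE sub.
Qed.

Lemma main_spec st : (forall a, 10 <= a -> iarr st a =1 fun=> 0) -> env0 st ->
  env (run main st) /\
  (iarr (run main st) 13 (rk (init A) * Z + rk (init A')) = 0 <-> masking A A').
Proof.
move=> st0 E0.
pose st1 := run tables st.
have E1 : env st1 by apply: tables_spec => // a; rewrite !inE => /or3P[] /eqP->; rewrite st0.
pose rounds := LFor 29 0 (LFor 30 3 round).
have -> : run main st = run rounds st1 by [].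
split; first exact: env_run.
have inner j s : env s -> rounds_inv j s ->
    rounds_inv (j + n' * 1) (run (LFor 30 3 round) s).
  move=> Es; apply: (@run_rep _ env rounds_inv 30 3 round 1 n') => //.
  - exact: env_n'.
  - move=> s1 fr1; exact: env_frame fr1 Es.
  - exact: round_inv.
have [M [rel up fin]] : rounds_inv (0 + n * (n' * 1)) (run rounds st1).
  apply: (@run_rep _ env rounds_inv 29 0 _ (n' * 1) n) => //.
  - exact: env_n.
  - move=> s1 fr1; exact: env_frame fr1 E1.
  (* Array 13 encodes related by 0, so fresh memory already holds the full relation. *)
  exists (fun _ _ => true); split=> //.
    by move=> s s'; have [i _] := run_frame tables st; rewrite i // st0.
  right; rewrite addn0; apply: leq_trans (max_card _) _.
  by rewrite card_prod.
have fixM s s' : M s s' -> masking_step M s s'.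
  (* After [n * n'] rounds the counting alternative leaves no pair at all, and the empty relation
     satisfies the clauses vacuously. *)
  case: fin => [|le]; first exact.
  have /eqP : #|[set p : S * S' | M p.1 p.2]| = 0.
    by move: le; rewrite add0n muln1 -[X in _ <= X]add0n leq_add2r leqn0 => /eqP.
  by rewrite cards_eq0 => /eqP/setP/(_ (s, s')); rewrite !inE /= => ->.
have -> : iarr (run rounds st1) 13 (rk (init A) * Z + rk (init A')) = 0 <->
    M (init A) (init A') by rewrite -rel; split=> /eqP.
split=> [Mi|[N maskN]]; last by apply: (up N maskN); case: maskN.
by exists M; split=> // s s' /fixM.
Qed.

(** * Running time in terms of the transition relations *)

Lemma card_le_trans (Act T : finType) (B : pts R T Act) : #|T| <= trans_size B.
Proof.
rewrite /trans_size -(size_map (fun x => x.1.1)) cardE uniq_leq_size ?enum_uniq // => x _.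
have [a [nu xan]] := trans_total B x.
by apply/mapP; exists (x, a, nu).
Qed.

Lemma masking_prog_correct : exists t st,
  [/\ exec masking_prog inp t st, t <= cost (7 * (m * m')) main + 60 &
      accepting st <-> masking A A'].
Proof.
pose st1 := seti inp 0 7 Z; pose st2 := seti st1 0 8 V.
have nm : n <= m := card_le_trans A; have nm' : n' <= m' := card_le_trans A'.
have n0 : 0 < n by apply/card_gt0P; exists (init A).
have n0' : 0 < n' by apply/card_gt0P; exists (init A').
have E0 : env0 st2.
  split=> //; first by do 7![case=> //].
  by move=> a; rewrite !inE => /or4P[] /eqP->.
have [|E acc] := main_spec (st := st2) _ E0; first by do 10![case=> //].
(* The largest loop bound is [Z], at most [2 * m + 2 * m' + 3], and thus at most [7 * (m * m')] as
   both sizes are positive. *)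
have [b|t [ex tc]] := @exec_compile R _ (7 * (m * m')) main st2 wf_main.
  have nZ : n <= Z by apply: leq_trans V_le_Z; apply: leq_addr.
  have n'Z : n' <= Z by apply: leq_trans V_le_Z; apply: leq_addl.
  rewrite !inE => bb; have : iarr st2 0 b <= Z.
    by case/orP: bb => [/eqP->|/orP[/eqP->|/orP[/eqP->|/orP[/eqP->|/orP[]/eqP->]]]];
      rewrite ?m_le_Z ?m'_le_Z ?V_le_Z.
  by move/leq_trans; apply; rewrite /Z; nia.
move: (run main st2) E acc ex => s3 E acc ex.
(* 15, 7 and 11 are the times of the three writes around [main]; each successor is a sequencing
   step. *)
exists (15 + (7 + (t + 11).+1).+1).+1.
exists (seti s3 0 0 (1 - iarr s3 13 (rk (init A) * Z + rk (init A')))).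
split; last first.
- rewrite -acc /accepting /= /upd /=.
  by case: (iarr _ 13 _).
- by lia.
apply: (@ExecSeq _ _ _ _ st1).
  exact: (ExecIWrite 0 (IConst 7) (IAdd (IAdd (par 0) (par 3))
    (IAdd (IAdd (par 1) (par 4)) (IConst 3))) inp).
apply: (@ExecSeq _ _ _ _ st2).
  exact: (ExecIWrite 0 (IConst 8) (IAdd (par 0) (par 3)) st1).
apply: (ExecSeq ex).
have := ExecIWrite 0 (IConst 0) (ISub (IConst 1) (IRead 13 (cell (par 2) (par 5)))) s3.
rewrite /= (env_i E) (env_i' E) (env_row E) //.
exact: ltnW (rk_ltZ (init A)).
Qed.

End Correctness.

Theorem theorem5 :
  exists (prog : com) (c k : nat),
  forall (R : realFieldType) (Sigma F S S' : finType)
    (A : pts R S Sigma) (A' : pts R S' (Sigma + F)%type),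
  exists (t : nat) (st : store R),
    exec prog (input A A') t st /\
    (t <= c * (trans_size A * trans_size A') ^ k)%N /\
    (accepting st <-> masking A A').
Proof.
have [C [K cost_main]] := cost_poly main.
(* [7 ^ K] comes from the loop bound [7 * (m * m')]; the additive 60 is absorbed because the product
   of the sizes is positive. *)
exists masking_prog, (C * 7 ^ K + 60), K => R Sigma F S S' A A'.
have [a [mu _]] := trans_total A (init A).
have [a' [mu' _]] := trans_total A' (init A').
have [t [st [ex tc acc]]] :=
  masking_prog_correct A A' (init A, a, mu) (init A', a', mu').
exists t, st; split=> //; split=> //.
have pos (Act T : finType) (B : pts R T Act) : 0 < trans_size B.
  by apply: leq_trans (card_le_trans B); apply/card_gt0P; exists (init B).
have B0 : 0 < trans_size A * trans_size A' by rewrite muln_gt0 !pos.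
apply: leq_trans tc _; rewrite mulnDl leq_add //; last by rewrite leq_pmulr ?expn_gt0 ?B0.
by rewrite -mulnA -expnMn cost_main // muln_gt0.
Qed.
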